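(* In the model and with the trapezoidal estimator $\hat g_n^{trap}$ described in the context, suppose that Assumptions (A), (B), (C) and (D) hold, that $f\in C^2([0,1])$, and that for any $t\in[0,1]$ the functions $f''$ and $R^{(0,2)}(t,\cdot)$ are all Lipschitz on $[0,1]$. If $\lim_{n\to\infty}h=0$ and $\lim_{n\to\infty}nh=\infty$, then for any $x\in\,]0,1[$, $$\mathrm{Var}(\hat g_n^{trap}(x))=\frac1m\Big(R(x,x)-\frac h2C_K\alpha(x)\Big)+\frac{V}{12mn^2h}\frac{\alpha(x)}{f^2(x)}+o\Big(\frac hm\Big)+O\Big(\frac1{mn^2}+\frac1{mn^3h^3}\Big),$$ where $V=\int_{-1}^1K^2(t)\,dt$ and $C_K=\int_{-1}^1\int_{-1}^1|u-v|K(u)K(v)\,du\,dv$.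
   Context: Model: $Y_j(t_i)=g(t_i)+\varepsilon_j(t_i)$, $j=1,\dots,m$, $i=1,\dots,n$, where $g\in C^2([0,1])$ is the unknown regression function and $(\varepsilon_j)_j$ are i.i.d. processes on $[0,1]$ distributed as a centered second-order process $\varepsilon$ with autocovariance function $R(s,t)=\mathbb E(\varepsilon(s)\varepsilon(t))$. Put $\overline Y(t)=\frac1m\sum_{j=1}^mY_j(t)$. Design: $f$ is a density on $[0,1]$ with $\inf_{[0,1]}f>0$, $\sup_{[0,1]}f<\infty$ and distribution function $F$; the regular sequence of designs generated by $f$ is $T_n=\{t_{i,n}=F^{-1}(i/n),\ i=1,\dots,n\}$, and observations are taken at $t_i=t_{i,n}$. Estimator: $K$ is a kernel ($\int K=1$) of support $[-1,1]$, $h=h(n,m)$ is a bandwidth with $0<h<1$, $\varphi_{x,h}(t)=\frac1hK\big(\frac{x-t}h\big)$. Let $N_{T_n}$ be the number of points of $T_n$ in $[x-h,x+h]$ and $t_{x,1}<\dots<t_{x,N_{T_n}}$ these points. For $x\in[0,1]$ the trapezoidal estimator is $$\hat g_n^{trap}(x)=\frac1{2n}\sum_{k=1}^{N_{T_n}-1}\Big\{\Big(\frac{\varphi_{x,h}}f\overline Y\Big)(t_{x,k})+\Big(\frac{\varphi_{x,h}}f\overline Y\Big)(t_{x,k+1})\Big\}.$$ Assumptions. (A) $R$ exists and is continuous on $[0,1]^2$. (B) On the diagonal $R$ has continuous left and right first-order derivatives $R^{(0,1)}(t,t^-)=\lim_{s\uparrow t}\frac{\partial R(t,s)}{\partial s}$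 and $R^{(0,1)}(t,t^+)=\lim_{s\downarrow t}\frac{\partial R(t,s)}{\partial s}$; the jump function $\alpha(t)=R^{(0,1)}(t,t^-)-R^{(0,1)}(t,t^+)$ is continuous and not identically equal to zero. (C) Off the diagonal $R$ has continuous mixed partial derivatives $R^{(i,j)}$ up to order two and $\sup_{0\le t\ne s\le1}|R^{(i,j)}(t,s)|<\infty$ for $0\le i+j\le2$. (D) $K$ is even, at least in $C^2([-1,1])$, and $K''$ is Lipschitz on $[-1,1]$. The symbols $O,o$ are taken as $n\to\infty$ with $h=h(n,m)$.
   Formalization: In Assumption (D), K is moreover required to be differentiable on the whole line, so K and K' vanish at -1 and 1; with C² on [-1,1] only in the one-sided sense the expansion fails, e.g. for the box kernel with h of order n^(-3/4). *)

(* Defs.v *)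
From HB Require Import structures.
From mathcomp Require Import all_boot all_order all_algebra finmap.
From mathcomp Require Import all_classical all_reals all_analysis.
Set Implicit Arguments.
Unset Strict Implicit.
Unset Printing Implicit Defensive.
Import Order.TTheory GRing.Theory Num.Theory.
Import numFieldNormedType.Exports.
Local Open Scope classical_set_scope.
Local Open Scope ring_scope.

Section Calculus.
Context {R : realType}.
Implicit Types (A : set R) (f : R -> R) (G : R -> R -> R).

(* Differentiation relative to A: at an end point of a closed interval this is
   the one-sided derivative, and only the values of f on A matter.  The
   library's derivable / derive1 use two-sided limits on the whole line. *)
Definition derivable_on A f (x : R) : Prop :=
  cvg ((f y - f x) / (y - x) @[y --> within A x^']).

Definition derive_on A f (x : R) : R :=
  lim ((f y - f x) / (y - x) @[y --> within A x^']).

Definition C2_on A f : Prop :=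
  [/\ {in A, forall x, derivable_on A f x},
      {in A, forall x, derivable_on A (derive_on A f) x}
    & {within A, continuous (derive_on A (derive_on A f))}].

Definition unit_itv : set R := `[0, 1]%classic.

Definition partial1 G : R -> R -> R :=
  fun t s => derive_on unit_itv (fun u => G u s) t.

Definition partial2 G : R -> R -> R :=
  fun t s => derive_on unit_itv (G t) s.

Definition mixed_partial (i j : nat) G : R -> R -> R :=
  iter i partial1 (iter j partial2 G).

Definition off_diagonal : set (R * R) :=
  [set p | [/\ unit_itv p.1, unit_itv p.2 & p.1 != p.2]].

(* G^(0,1)(t, t^-), meaningful for 0 < t <= 1. *)
Definition diag_left G (t : R) : R :=
  lim (mixed_partial 0 1 G t s @[s --> t^'-]).

(* G^(0,1)(t, t^+), meaningful for 0 <= t < 1. *)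
Definition diag_right G (t : R) : R :=
  lim (mixed_partial 0 1 G t s @[s --> t^'+]).

Definition jump G (t : R) : R := diag_left G t - diag_right G t.

Definition assumptionA G : Prop :=
  {within unit_itv `*` unit_itv, continuous (fun p : R * R => G p.1 p.2)}.

Definition assumptionB G : Prop :=
  [/\ {in `]0, 1], forall t, cvg (mixed_partial 0 1 G t s @[s --> t^'-])} /\
      {in `[0, 1[, forall t, cvg (mixed_partial 0 1 G t s @[s --> t^'+])},
      {within `]0, 1], continuous (diag_left G)} /\
      {within `[0, 1[, continuous (diag_right G)},
      {within `]0, 1[, continuous (jump G)}
    & exists2 t, t \in `]0, 1[ & jump G t != 0].

(* The first two conjuncts say that G^(i,j) exists off the diagonal for
   i + j <= 2: G^(i+1,j) is the derivative of G^(i,j) in its first argument and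
   G^(0,j+1) that of G^(0,j) in its second one. *)
Definition assumptionC G : Prop :=
  [/\ forall i j, (i + j <= 1)%N -> forall t s, off_diagonal (t, s) ->
        derivable_on unit_itv (fun u => mixed_partial i j G u s) t,
      forall j, (j <= 1)%N -> forall t s, off_diagonal (t, s) ->
        derivable_on unit_itv (mixed_partial 0 j G t) s,
      forall i j, (i + j <= 2)%N ->
        {within off_diagonal,
          continuous (fun p : R * R => mixed_partial i j G p.1 p.2)}
    & forall i j, (i + j <= 2)%N -> exists M : R,
        forall p, off_diagonal p -> `|mixed_partial i j G p.1 p.2| <= M].

(* G^(0,2)(t, .) does not exist at t, so the Lipschitz condition is imposed on
   each side of t. *)
Definition lipschitz_mixed02 G : Prop :=
  forall t, unit_itv t ->
    [lipschitz mixed_partial 0 2 G t s | s in `[0, t[] /\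
    [lipschitz mixed_partial 0 2 G t s | s in `]t, 1]].

Definition second_deriv_lipschitz A f : Prop :=
  [lipschitz derive_on A (derive_on A f) u | u in A].

Definition kernel_function (K : R -> R) : Prop :=
  closure [set u | K u != 0] = `[-1, 1]%classic /\
  \int[lebesgue_measure]_u K u = 1.

(* As a function on the line with support [-1, 1], K is differentiable
   everywhere, hence K and K' vanish at -1 and 1; its second derivative is
   one-sided at -1 and 1 and need not vanish there (e.g. the biweight kernel).
   For a kernel that jumps or has a kink at -1 and 1 (box, Epanechnikov) the end
   points of the trapezoidal sum contribute errors of order 1/(nh), resp.
   1/(nh)^2, and the variance expansion fails. *)
Definition assumptionD (K : R -> R) : Prop :=
  [/\ forall u, K (- u) = K u,
      forall u, derivable K u 1,
      C2_on `[-1, 1] K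
    & second_deriv_lipschitz `[-1, 1] K].

Definition density01 f : Prop :=
  [/\ 0 < inf (f @` unit_itv),
      has_ubound (f @` unit_itv)
    & \int[lebesgue_measure]_(u in unit_itv) f u = 1].

Definition distribution_function f (t : R) : R :=
  \int[lebesgue_measure]_(u in `[0, t]) f u.

Definition quantile f (p : R) : R :=
  inf [set t | unit_itv t /\ p <= distribution_function f t].

Definition design_point f (n i : nat) : R := quantile f (i%:R / n%:R).

(* The points t_{x,1} < ... < t_{x,N} in increasing order: design_point f n is
   increasing in i. *)
Definition local_design f (n : nat) (x h : R) : seq R :=
  [seq t <- [seq design_point f n i | i <- iota 1 n] | x - h <= t <= x + h].

Definition phi (K : R -> R) (x h t : R) : R := h^-1 * K ((x - t) / h).

Definition kernel_V (K : R -> R) : R :=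
  \int[lebesgue_measure]_(t in `[-1, 1]) (K t ^+ 2).

Definition kernel_C (K : R -> R) : R :=
  \int[lebesgue_measure]_(u in `[-1, 1])
    \int[lebesgue_measure]_(v in `[-1, 1]) (`|u - v| * K u * K v).

Definition ghat_trap (K f : R -> R) (n : nat) (h : R) (Ybar : R -> R) (x : R)
    : R :=
  let ts := local_design f n x h in
  let a := fun t => phi K x h t / f t * Ybar t in
  (2 * n%:R)^-1 * \sum_(k < (size ts).-1) (a ts`_k + a ts`_k.+1).

End Calculus.

Section Processes.
Context {R : realType}.

(* A process on [0, 1] is a family X : R -> Omega -> R of which only the
   X t with t in [0, 1] matter. *)

Definition centered_second_order d (Omega : measurableType d)
    (P : probability Omega R) (X : R -> {RV P >-> R}) : Prop :=
  forall t, unit_itv t ->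
    (X t : Omega -> R) \in Lfun P 2%:E /\ ('E_P[X t] = 0)%E.

Definition autocovariance d (Omega : measurableType d)
    (P : probability Omega R) (X : R -> {RV P >-> R}) (s t : R) : R :=
  fine 'E_P[(X s : Omega -> R) \* X t]%E.

Definition same_process_law d d' (Omega : measurableType d)
    (Omega' : measurableType d') (P : probability Omega R)
    (P' : probability Omega' R) (X : R -> {RV P >-> R})
    (X' : R -> {RV P' >-> R}) : Prop :=
  forall (k : nat) (s : k.-tuple R), (forall i, unit_itv (tnth s i)) ->
  forall B : set (k.-tuple R), measurable B ->
    P [set w | B (map_tuple (fun u => X u w) s)] =
    P' [set w | B (map_tuple (fun u => X' u w) s)].

Definition process_sigma_algebra d (Omega : measurableType d)
    (P : probability Omega R) (X : R -> {RV P >-> R}) : set (set Omega) :=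
  <<s [set A | exists t (B : set R),
        [/\ unit_itv t, measurable B & A = X t @^-1` B]] >>.

Definition independent_processes d (Omega : measurableType d)
    (P : probability Omega R) (X : nat -> R -> {RV P >-> R}) : Prop :=
  forall (J : {fset nat}) (A : nat -> set Omega),
    (forall j, j \in J -> process_sigma_algebra (X j) (A j)) ->
    (P (\bigcap_(j in [set` J]) A j) = \prod_(j <- J) P (A j))%E.

Definition iid_copies d d' (Omega : measurableType d)
    (Omega' : measurableType d') (P : probability Omega R)
    (P' : probability Omega' R) (X : nat -> R -> {RV P >-> R})
    (X' : R -> {RV P' >-> R}) : Prop :=
  independent_processes X /\ forall j, same_process_law (X j) X'.

Definition Yobs d (Omega : measurableType d) (P : probability Omega R)
    (g : R -> R) (eps : nat -> R -> {RV P >-> R}) (j : nat) (t : R)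
    (w : Omega) : R :=
  g t + eps j t w.

(* The m replications are numbered from 0. *)
Definition Ymean d (Omega : measurableType d) (P : probability Omega R)
    (g : R -> R) (eps : nat -> R -> {RV P >-> R}) (m : nat) (t : R)
    (w : Omega) : R :=
  m%:R^-1 * \sum_(j < m) Yobs g eps j t w.

End Processes.

(* Main.v *)
(** Since the replications are independent and centred, the variance is S/m with
    S the sum of the a_i a_j R(t_i, t_j), the a_i being the trapezoidal weights.
    Assumptions (A)-(C) give, uniformly for s, t within h of x,
    R(t, s) = R(x, x) + beta ((t - x) + (s - x)) - alpha(x)/2 |t - s| + o(h).
    Hence S is governed by the total weight, the first moment of the weights and
    the double sum of the a_i a_j |t_i - t_j|.  The last two are multiplied by h,
    and a plain Riemann sum estimate, of relative error O(1/(nh)), is enough for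
    them.  The total weight has to be 1 up to O((nh)^-3) + o(h); this is an
    Euler-Maclaurin expansion whose boundary terms vanish with K and K' at the end
    points of the support, up to the nonuniformity of the design over the window,
    which is of relative order h.  As nh tends to infinity, 1/n and 1/(n^2 h) are
    o(h): errors of that size, and the term in V itself, are absorbed in o(h/m). *)

Require Import Defs.
From HB Require Import structures.
From mathcomp Require Import all_boot all_order all_algebra finmap.
From mathcomp Require Import all_classical all_reals all_analysis.
From mathcomp Require Import measurable_realfun ring lra.
Set Implicit Arguments.
Unset Strict Implicit.
Unset Printing Implicit Defensive.
Import Order.TTheory GRing.Theory Num.Theory.
Import numFieldNormedType.Exports.
Local Open Scope classical_set_scope.
Local Open Scope ring_scope.

(** * Variance of linear statistics of the replications *)

(** Everything is rescaled by [u i = (T i - x) / h], so that the grid cells have lengths [d i] of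
    order [eta = 1 / (n h)]. K is C^2 only piecewise: a cell containing -1 or 1 has a defect of
    order eta^3, any other one a defect of order eta^4. At most two cells are of the first kind, and
    about 1 / eta cells of the second kind meet the support, so both kinds contribute eta^3; this is
    the origin of the term in 1 / (n h)^3. Instead of counting cells, each local error is compared
    with the increment of a bounded monotone function, and the sum telescopes. Halving the two end
    weights costs eta^3 as well, because K vanishes quadratically at the ends of its support. The
    total error is at most Q eta^3 + e h for every e > 0 and n large, with Q chosen before e;
    truncating it at the level Q eta^3 then yields one decomposition into an O part and an o part,
    the same for all e. *)

Section Expectations.
Context d (T : measurableType d) (R : realType) (P : probability T R).
Local Open Scope ereal_scope.

Lemma expectation_big (I : Type) (s : seq I) (F : I -> T -> R) :
  (forall i, F i \in Lfun P 1) ->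
  'E_P[fun w => (\sum_(i <- s) F i w)%R] = \sum_(i <- s) 'E_P[F i].
Proof.
move=> F1; elim: s => [|i s IH].
  by rewrite big_nil (_ : (fun _ => _) = cst 0%R) ?expectation_cst//;
    apply/funext => w; rewrite big_nil.
rewrite big_cons -IH -expectationD//; last first.
  have -> : (fun w => \sum_(i <- s) F i w)%R = (\sum_(i <- s) F i)%R.
    by apply/funext => w; rewrite fct_sumE.
  by rewrite rpred_sum.
by congr ('E_P[_]); apply/funext => w; rewrite big_cons.
Qed.

Lemma variance_centered_sum (I : Type) (s : seq I) (c : I -> R) (c0 : R)
    (X : I -> T -> R) :
  (forall i, X i \in Lfun P 1) -> (forall i, 'E_P[X i] = 0) ->
  (forall i j, (X i \* X j)%R \in Lfun P 1) ->
  variance P (fun w => (c0 + \sum_(i <- s) c i * X i w)%R) =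
  (\sum_(i <- s) \sum_(j <- s) c i * c j * fine 'E_P[X i \* X j])%R%:E.
Proof.
move=> X1 X0 XX1.
have cX1 i : (c i \o* X i)%R \in Lfun P 1 by exact: Lfun_scale.
have EZ : 'E_P[fun w => (c0 + \sum_(i <- s) c i * X i w)%R] = c0%:E.
  rewrite (_ : (fun w => _) = (cst c0 \+ fun w => \sum_(i <- s) (c i \o* X i) w)%R);
    last first.
    by apply/funext => w /=; congr (_ + _)%R; apply: eq_bigr => i _; rewrite mulrC.
  rewrite expectationD; last 2 first.
  - exact: Lfun_cst.
  - have -> : (fun w => \sum_(i <- s) (c i \o* X i) w)%R
        = (\sum_(i <- s) (c i \o* X i))%R.
      by apply/funext => w; rewrite fct_sumE.
    by rewrite rpred_sum.
  rewrite expectation_cst expectation_big// big1 ?adde0// => i _.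
  by rewrite expectationZl// X0 mule0.
rewrite /variance unlock EZ/=.
have -> : ((fun w => (c0 + \sum_(i <- s) c i * X i w)) \- cst c0)%R =
    (fun w => \sum_(i <- s) c i * X i w)%R.
  by apply/funext => w /=; rewrite addrC addKr.
have XXc i j : (c i * c j \o* (X i \* X j))%R \in Lfun P 1 by exact: Lfun_scale.
(* The square of the sum becomes a single sum over pairs of indices, to which linearity applies. *)
rewrite [X in 'E_P[X]](_ : _ = fun w => (\sum_(p <- allpairs pair s s)
    (c p.1 * c p.2 \o* (X p.1 \* X p.2)) w)%R); last first.
  apply/funext => w /=; rewrite -[LHS]/(_ * _)%R.
  rewrite big_allpairs mulr_suml; apply: eq_bigr => i _.
  by rewrite mulr_sumr; apply: eq_bigr => j _ /=; ring.
rewrite expectation_big// big_allpairs -sumEFin; apply: eq_bigr => i _.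
rewrite -sumEFin; apply: eq_bigr => j _.
by rewrite expectationZl// [RHS]EFinM fineK// expectation_fin_num.
Qed.

(* The law of (X, Y) is the product of the two laws by uniqueness of the product
   measure, so Fubini's theorem applies. *)
Lemma expectation_mul_independent (X Y : {RV P >-> R}) :
  (X : T -> R) \in Lfun P 1 -> (Y : T -> R) \in Lfun P 1 ->
  (forall A B, measurable A -> measurable B ->
    P (X @^-1` A `&` Y @^-1` B) = P (X @^-1` A) * P (Y @^-1` B)) ->
  ((X : T -> R) \* Y)%R \in Lfun P 1 /\
  'E_P[(X : T -> R) \* Y] = 'E_P[X] * 'E_P[Y].
Proof.
move=> X1 Y1 XY.
have mXY : measurable_fun [set: T] (fun w => (X w, Y w)).
  exact: measurable_fun_pair.
pose XYm : {mfun T >-> (R * R)%type} := HB.pack (fun w => (X w, Y w))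
  (isMeasurableFun.Build _ _ _ _ _ mXY).
have prodE B : measurable B ->
    (distribution P X \x distribution P Y) B = distribution P XYm B.
  by apply: product_measure_unique => A C mA mC; rewrite -XY.
pose f (p : R * R) : \bar R := (p.1 * p.2)%:E.
have mf : measurable_fun [set: R * R] f.
  by apply/measurable_EFinP; apply: measurable_funM.
have iX : P.-integrable setT (EFin \o X) by apply/Lfun1_integrable.
have iY : P.-integrable setT (EFin \o Y) by apply/Lfun1_integrable.
have mabs : measurable_fun setT (fun r : R => `|r%:E|).
  by apply: measurableT_comp.
have iXd : \int[distribution P X]_x `|x%:E| < +oo.
  rewrite ge0_integral_distribution//.
  by case/integrableP : iX.
have iYd : \int[distribution P Y]_x `|x%:E| < +oo.
  rewrite ge0_integral_distribution//.
  by case/integrableP : iY.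
have iYd' : (distribution P Y).-integrable setT EFin.
  by apply/integrableP; split.
(* Tonelli: the iterated integral of the absolute value factors into E|X| E|Y|, which is finite. *)
have intf : (distribution P X \x distribution P Y).-integrable setT f.
  apply/integrable12ltyP => //.
  have absf (x y : R) : `|f (x, y)| = `|x%:E| * `|y%:E| by rewrite -abseM -EFinM.
  under eq_integral => x _.
    under eq_integral => y _ do rewrite absf.
    rewrite ge0_integralZl//; over.
  rewrite ge0_integralZr//; last exact: integral_ge0.
  have ? : 0 <= \int[distribution P Y]_x `|x%:E| by exact: integral_ge0.
  apply: lte_mul_pinfty => //; first exact: integral_ge0.
  by rewrite ge0_fin_numE// integral_ge0.
have iXY : P.-integrable setT (fun w => (X w * Y w)%:E).
  apply/integrableP; split.
    by apply/measurable_EFinP; apply: measurable_funM.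
  have /integrableP[_] := intf.
  have -> : \int[distribution P X \x distribution P Y]_x `|f x| =
      \int[distribution P XYm]_x `|f x|.
    by apply: eq_measure_integral => A mA _; exact: prodE.
  rewrite ge0_integral_distribution//; first exact: measurableT_comp.
split; first by apply/Lfun1_integrable.
have Ef (Z : {RV P >-> R}) : 'E_P[Z] = \int[P]_w (Z w)%:E by rewrite unlock.
transitivity (\int[distribution P XYm]_z f z).
  by rewrite unlock integral_distribution.
transitivity (\int[distribution P X \x distribution P Y]_z f z).
  by apply: eq_measure_integral => A mA _; exact/esym/prodE.
transitivity (\int[distribution P X]_x \int[distribution P Y]_y f (x, y)).
  exact/esym/integral12_prod_meas1.
have EY : \int[distribution P Y]_y y%:E = 'E_P[Y].
  by rewrite integral_distribution// Ef.
transitivity (\int[distribution P X]_x (x%:E * 'E_P[Y])).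
  by apply: eq_integral => x _; rewrite -EY -integralZl.
have EYf : 'E_P[Y] \is a fin_num by exact: expectation_fin_num.
have iXd' : (distribution P X).-integrable setT EFin.
  by apply/integrableP; split.
rewrite -(fineK EYf) integralZr//.
by rewrite integral_distribution// (Ef X).
Qed.

End Expectations.

(** * Moments of the replications, deduced from the law of the model process *)

Section Replications.
Context {R : realType} d d0 (Omega : measurableType d) (P : probability Omega R)
  (Omega0 : measurableType d0) (P0 : probability Omega0 R).
Variables (eps : nat -> R -> {RV P >-> R}) (eps0 : R -> {RV P0 >-> R}).
Local Open Scope ereal_scope.

(** Both expectations are integrals of [q] against the law of a 2-tuple, and the finite-dimensional
    law at (s, t) is the same for the two processes. The points s and t may coincide. *)
Lemma same_law_integral (X : R -> {RV P >-> R}) (X' : R -> {RV P0 >-> R})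
    (s t : R) (q : R * R -> R) :
  same_process_law X X' -> unit_itv s -> unit_itv t ->
  measurable_fun setT q ->
  (fun w => q (X' s w, X' t w)) \in Lfun P0 1 ->
  (fun w => q (X s w, X t w)) \in Lfun P 1 /\
  'E_P[fun w => q (X s w, X t w)] = 'E_P0[fun w => q (X' s w, X' t w)].
Proof.
move=> law us ut mq /Lfun1_integrable i0.
have mtup d' (Q : measurableType d') (f g : Q -> R) :
    measurable_fun setT f -> measurable_fun setT g ->
    measurable_fun setT (fun w => [tuple f w; g w]).
  move=> mf mg; apply: measurable_cons => //.
  exact: (@measurable_cons _ _ _ _ g 0 (fun=> [tuple])).
pose XX : {mfun Omega >-> (2.-tuple R)} := HB.pack (fun w => [tuple X s w; X t w])
  (isMeasurableFun.Build _ _ _ _ _ (mtup _ _ _ _ (measurable_funPT (X s))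
    (measurable_funPT (X t)))).
pose XX' : {mfun Omega0 >-> (2.-tuple R)} := HB.pack (fun w => [tuple X' s w; X' t w])
  (isMeasurableFun.Build _ _ _ _ _ (mtup _ _ _ _ (measurable_funPT (X' s))
    (measurable_funPT (X' t)))).
have lawE B : measurable B -> distribution P XX B = distribution P0 XX' B.
  move=> mB.
  have := law 2%N [tuple s; t] _ B mB.
  have -> : [set w | B (map_tuple (X^~ w) [tuple s; t])] = XX @^-1` B.
    apply/seteqP; split => w /=; rewrite (_ : map_tuple _ _ = [tuple X s w; X t w])//;
    exact: val_inj.
  have -> : [set w | B (map_tuple (X'^~ w) [tuple s; t])] = XX' @^-1` B.
    apply/seteqP; split => w /=; rewrite (_ : map_tuple _ _ = [tuple X' s w; X' t w])//;
    exact: val_inj.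
  apply=> i; case: i => -[|[|//]] Hi;
    by rewrite /tnth/=.
pose f (z : 2.-tuple R) : \bar R := (q (tnth z ord0, tnth z ord_max))%:E.
have mf : measurable_fun [set: 2.-tuple R] f.
  apply/measurable_EFinP; apply: (measurableT_comp mq).
  by apply: measurable_fun_pair; exact: measurable_tnth.
have i1 : P.-integrable setT (f \o XX).
  apply/integrableP; split.
    by apply: measurableT_comp.
  case/integrableP : i0 => _.
  have mabs : measurable_fun [set: 2.-tuple R] (fun z => `|f z|).
    exact: measurableT_comp.
  rewrite -(ge0_integral_distribution XX mabs) ?abse_ge0//.
  have -> : \int[distribution P XX]_z `|f z| = \int[distribution P0 XX']_z `|f z|.
    by apply: eq_measure_integral => A mA _; exact: lawE.
  by rewrite ge0_integral_distribution.
split; first by apply/Lfun1_integrable.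
have i0' : P0.-integrable setT (f \o XX') by [].
rewrite unlock -[LHS](integral_distribution mf i1) -[RHS](integral_distribution mf i0').
by apply: eq_measure_integral => A mA _; exact: lawE.
Qed.

Lemma process_sigma_algebra_preimage (X : R -> {RV P >-> R}) (t : R)
    (B : set R) : unit_itv t -> measurable B ->
  process_sigma_algebra X (X t @^-1` B).
Proof. by move=> ut mB; apply: sub_sigma_algebra; exists t, B. Qed.

Hypothesis eps0_L2 : centered_second_order eps0.
Hypothesis eps_iid : iid_copies eps eps0.

Let eps0_mul_L1 s t : unit_itv s -> unit_itv t ->
  ((eps0 s : Omega0 -> R) \* eps0 t)%R \in Lfun P0 1.
Proof.
by move=> /eps0_L2[s2 _] /eps0_L2[t2 _]; exact: Lfun2_mul_Lfun1.
Qed.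

Let eps0_L1 s : unit_itv s -> (eps0 s : Omega0 -> R) \in Lfun P0 1.
Proof.
move=> /eps0_L2[s2 _]; apply: Lfun_subset12 => //.
exact: fin_num_measure.
Qed.

Lemma iid_copies_centered j t : unit_itv t ->
  (eps j t : Omega -> R) \in Lfun P 1 /\ 'E_P[eps j t] = 0.
Proof.
(* The one-dimensional law is read off the pair (t, t), with the first projection as [q]. *)
move=> ut; have [t1 tE] := @same_law_integral (eps j) eps0 t t fst (eps_iid.2 j)
  ut ut (measurable_fst) (eps0_L1 ut).
by split=> //; rewrite tE; case: (eps0_L2 ut).
Qed.

Lemma iid_copies_covariance j k s t : unit_itv s -> unit_itv t ->
  ((eps j s : Omega -> R) \* eps k t)%R \in Lfun P 1 /\
  fine 'E_P[(eps j s : Omega -> R) \* eps k t] =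
  (if j == k then autocovariance eps0 s t else 0)%R.
Proof.
move=> us ut; have [<-|jk] := eqVneq j k.
  have [? ->] := @same_law_integral (eps j) eps0 s t (fun p => p.1 * p.2)%R
    (eps_iid.2 j) us ut (measurable_funM measurable_fst measurable_snd)
    (eps0_mul_L1 us ut).
  by split.
have [s1 s0] := iid_copies_centered j us.
have [t1 t0] := iid_copies_centered k ut.
have [|st1 ->] := expectation_mul_independent s1 t1; last first.
  by split=> //; rewrite s0 mul0e.
move=> A B mA mB.
(* Independence is stated for families of events over all of nat; only the values of [E] at j and k
   enter the intersection over {j, k}. *)
pose E i := if i == j then eps j s @^-1` A else eps k t @^-1` B.
have := eps_iid.1 [fset j; k]%fset E.
rewrite (_ : \bigcap_(_ in _) _ = eps j s @^-1` A `&` eps k t @^-1` B); last first.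
  apply/seteqP; split=> w /=.
    move=> H; split; have := H; rewrite /E.
      by move=> /(_ j); rewrite eqxx; apply; rewrite /= !inE eqxx.
    by move=> /(_ k); rewrite eq_sym (negPf jk); apply; rewrite /= !inE eqxx orbT.
  move=> [HA HB] i; rewrite /= !inE /E => /orP[]/eqP->; first by rewrite eqxx.
  by rewrite eq_sym (negPf jk).
rewrite big_fsetU1 ?inE//= big_seq_fset1 /E eqxx eq_sym (negPf jk); apply.
move=> i; rewrite /E !inE => /orP[]/eqP->.
  by rewrite eqxx; exact: process_sigma_algebra_preimage.
by rewrite eq_sym (negPf jk); exact: process_sigma_algebra_preimage.
Qed.

(* Only the diagonal pairs j = k of replications contribute. *)
Lemma variance_linear_Ymean (I : Type) (s : seq I) (a tau : I -> R) (g : R -> R)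
    (m : nat) : (0 < m)%N -> (forall i, unit_itv (tau i)) ->
  variance P (fun w => (\sum_(i <- s) a i * Ymean g eps m (tau i) w)%R) =
  (m%:R^-1 * \sum_(i <- s) \sum_(k <- s)
     a i * a k * autocovariance eps0 (tau i) (tau k))%R%:E.
Proof.
move=> m0 utau.
pose X (p : I * 'I_m) : Omega -> R := eps p.2 (tau p.1).
(* A deterministic constant plus a linear form in the centred variables [X], indexed by a design
   index and a replication. *)
rewrite (_ : (fun w => _) = fun w => (\sum_(i <- s) a i * g (tau i) +
  \sum_(p <- allpairs pair s (enum 'I_m)) a p.1 / m%:R * X p w)%R); last first.
  apply/funext => w; rewrite big_allpairs -big_split/=; apply: eq_bigr => i _.
  rewrite /Ymean /Yobs/= big_split/= sumr_const card_ord mulrDr mulrDr.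
  rewrite -[X in (_ * (_ * X))%R]mulr_natl mulKf ?pnatr_eq0 -?lt0n//; congr (_ + _)%R.
  rewrite mulrA mulr_sumr big_enum; apply: eq_bigr => j _ //.
rewrite variance_centered_sum; last 3 first.
- by move=> p; have [] := iid_copies_centered p.2 (utau p.1).
- by move=> p; have [] := iid_copies_centered p.2 (utau p.1).
- by move=> p q; have [] := iid_copies_covariance p.2 q.2 (utau p.1) (utau q.1).
congr (_%:E).
rewrite big_allpairs mulr_sumr; apply: eq_bigr => i _.
rewrite exchange_big/= big_allpairs mulr_sumr; apply: eq_bigr => k _.
transitivity (\sum_(j : 'I_m) a i * a k / m%:R ^+ 2 *
    autocovariance eps0 (tau i) (tau k))%R.
  rewrite big_enum/=; apply: eq_bigr => j _; rewrite big_enum/= (bigD1 j)//= big1 ?addr0.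
    have [_ ->] := iid_copies_covariance j j (utau i) (utau k).
    by rewrite eqxx; field; rewrite pnatr_eq0 -lt0n.
  move=> l lj; have [_ ->] := iid_copies_covariance l j (utau i) (utau k).
  by rewrite ifN ?mulr0// .
rewrite sumr_const card_ord -mulr_natl.
by field; rewrite pnatr_eq0 -lt0n.
Qed.

End Replications.

(** * Calculus relative to a set *)

Section OneSidedCalculus.
Context {R : realType}.
Implicit Types (f : R -> R) (a b x : R).

Lemma cvg_derive_on (A : set R) f x : derivable_on A f x ->
  forall e : R, 0 < e -> \forall y \near x, A y -> y != x ->
    `|f y - f x - derive_on A f x * (y - x)| <= e * `|y - x|.
Proof.
move=> cf e e0.
have : (f y - f x) / (y - x) @[y --> within A x^'] --> derive_on A f x by exact: cf.
move=> /cvgrPdist_le /(_ e e0) H.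
have {}H : nbhs x (fun y => y != x -> A y ->
    `|derive_on A f x - (f y - f x) / (y - x)| <= e) by exact: H.
apply: filterS H => y + Ay yx => /(_ yx Ay).
have y0 : 0 < `|y - x| by rewrite normr_gt0 subr_eq0.
move=> /(ler_wpM2r (ltW y0)); rewrite -normrM; apply: le_trans.
by rewrite mulrBl divfK ?subr_eq0 // distrC.
Qed.

Lemma derivable_on_continuous (A : set R) f :
  (forall x, A x -> derivable_on A f x) -> {within A, continuous f}.
Proof.
move=> df; apply/subspace_continuousP => x Ax; apply/cvgrPdist_le => e e0.
set D := derive_on A f x.
have D0 : 0 < 1 + `|D| by rewrite ltr_pwDl.
have H1 := cvg_derive_on (df x Ax) ltr01.
have H2 : \forall y \near x, `|y - x| <= e / (1 + `|D|).
  apply/nbhs_ballP; exists (e / (1 + `|D|)); first by rewrite /= divr_gt0.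
  by move=> y; rewrite /ball/= distrC => /ltW.
suff : nbhs x (fun y => A y -> `|f x - f y| <= e) by [].
apply: filterS2 H1 H2 => y h1 h2 Ay.
have [->|yx] := eqVneq y x; first by rewrite subrr normr0 ltW.
move: (h1 Ay yx) => {}h1.
rewrite distrC -[f y - f x](subrK (D * (y - x))).
have -> : e = (1 + `|D|) * (e / (1 + `|D|)) by rewrite mulrC divfK// gt_eqF.
apply: (le_trans (ler_normD _ _)); rewrite normrM.
apply: (@le_trans _ _ ((1 + `|D|) * `|y - x|)).
  by rewrite mulrDl lerD// h1.
by rewrite ler_wpM2l// ltW.
Qed.

(** At an interior point of [A] the restricted limit is two-sided. This is the passage from the
    assumptions, stated relative to a set, to the usual rules of calculus and the mean value
    theorem. *)
Lemma derivable_on_is_derive (A : set R) f x : nbhs x A ->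
  derivable_on A f x -> is_derive x (1 : R) f (derive_on A f x).
Proof.
move=> nA df.
have H : (h^-1 *: (f (h + x) - f x)) @[h --> 0^'] --> derive_on A f x.
  apply/cvgrPdist_le => e e0.
  have H1 := cvg_derive_on df e0.
  have {}H1 : \forall y \near x, y != x ->
      `|f y - f x - derive_on A f x * (y - x)| <= e * `|y - x|.
    by apply: filterS2 H1 nA => y H1 Ay; exact: H1.
  have {}H1 : \forall h \near (0 : R), h != 0 ->
      `|f (h + x) - f x - derive_on A f x * h| <= e * `|h|.
    have : (h + x) @[h --> (0 : R)] --> x.
      by rewrite -[X in _ --> X]add0r; apply: cvgD; [exact: cvg_id|exact: cvg_cst].
    move=> cv; have H2 : nbhs (0 : R) (fun h => h + x != x ->
      `|f (h + x) - f x - derive_on A f x * (h + x - x)| <= e * `|h + x - x|).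
      exact: cv _ H1.
    apply: filterS H2 => h; rewrite addrK => H2 h0; apply: H2.
    by rewrite -subr_eq0 addrK.
  rewrite /dnbhs /within/=; apply: filterS H1 => h H1 h0.
  have {}h0 : h != 0 by [].
  have h00 : 0 < `|h| by rewrite normr_gt0.
  suff : `|derive_on A f x - h^-1 * (f (h + x) - f x)| * `|h| <= e * `|h|.
    by rewrite ler_pM2r.
  by rewrite -normrM mulrBl mulrAC mulVf// mul1r distrC; exact: H1.
have -> : derive_on A f x = 'D_1 f x.
  apply/esym/cvg_lim => //; move: H; apply: cvg_trans; apply: near_eq_cvg.
  by apply: nearW => h; rewrite /GRing.scale/= mulr1.
apply/derivableP; apply/cvg_ex; exists (derive_on A f x).
move: H; apply: cvg_trans; apply: near_eq_cvg.
by apply: nearW => h; rewrite /GRing.scale/= mulr1.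
Qed.

(* A derivative on the whole line restricts to A, which must accumulate at x for
   the restricted limit to be determined. *)
Lemma derive_on_is_derive (A : set R) f x (l : R) :
  ProperFilter (within A x^') -> is_derive x (1 : R) f l ->
  derivable_on A f x /\ derive_on A f x = l.
Proof.
move=> pf df.
have H : (f y - f x) / (y - x) @[y --> within A x^'] --> l.
  apply/cvgrPdist_le => e e0.
  have : (h^-1 *: (f (h *: (1 : R) + x) - f x)) @[h --> 0^'] --> l.
    by case: df => dfx <-; exact: dfx.
  move=> /cvgrPdist_le /(_ e e0); rewrite /dnbhs /within/= => H1.
  have H2 : (y - x) @[y --> x] --> (0 : R).
    by apply/subr_cvg0; exact: cvg_id.
  have H3 : nbhs x (fun y => y - x != 0 ->
    `|l - (y - x)^-1 *: (f ((y - x) *: (1 : R) + x) - f x)| <= e) by exact: H2 _ H1.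
  suff : nbhs x (fun y => y != x -> A y -> `|l - (f y - f x) / (y - x)| <= e) by [].
  apply: filterS H3 => y /= + yx Ay.
  rewrite /GRing.scale/= mulr1 subrK mulrC; apply.
  by rewrite subr_eq0.
by split; [apply/cvg_ex; exists l|apply/cvg_lim].
Qed.

(** The derivative is asked for on the open interval only. This allows intervals that end on the
    diagonal of the covariance, or at -1 and 1 for the kernel, where only one-sided information is
    available. *)
Lemma mvt_norm_le f (df : R -> R) a b (C : R) : a <= b ->
  (forall x, a < x < b -> is_derive x (1 : R) f (df x)) ->
  {within `[a, b], continuous f} ->
  (forall x, a < x < b -> `|df x| <= C) -> `|f b - f a| <= C * (b - a).
Proof.
rewrite le_eqVlt => /predU1P[->|ab] df1 cf dfC.
  by rewrite !subrr normr0 mulr0.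
have df1' x : x \in `]a, b[ -> is_derive x (1 : R) f (df x).
  by rewrite in_itv/=; exact: df1.
have [c] := MVT ab df1' cf; rewrite in_itv/= => cab ->.
have ba : 0 < b - a by rewrite subr_gt0.
by rewrite normrM (gtr0_norm ba) ler_wpM2r ?(ltW ba)//; exact: dfC.
Qed.

Lemma is_derive_within_continuous f (df : R -> R) (A : set R) :
  (forall x, A x -> is_derive x (1 : R) f (df x)) -> {within A, continuous f}.
Proof.
move=> H; apply/subspace_continuousP => x Ax.
apply: (@cvg_within_filter _ _ f (nbhs x)).
have := H x Ax => Hx.
apply: differentiable_continuous; exact/derivable1_diffP.
Qed.

End OneSidedCalculus.

(** * The covariance near the diagonal *)

Lemma lim_dist_le {R : realType} (F : set_system R) (u : R -> R) (l y C : R) :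
  ProperFilter F -> u s @[s --> F] --> l ->
  (\forall s \near F, `|u s - y| <= C) -> `|l - y| <= C.
Proof.
move=> pF ul uy; apply/ler_addgt0Pr => e e0.
move/cvgrPdist_le : ul => /(_ e e0) ul.
have [s [h1 h2]] := filter_ex (filterI ul uy).
rewrite -(subrK (u s) l) -addrA addrC.
by rewrite (le_trans (ler_normD _ _))// lerD.
Qed.

Lemma nbhs_unit_itv {R : realType} (x : R) : 0 < x < 1 -> nbhs x (unit_itv (R := R)).
Proof.
move=> x01; have : x \in `]0, 1[ by rewrite in_itv.
move=> /near_in_itvoo; apply: filterS => y; rewrite !in_itv/= => /andP[? ?].
by rewrite /unit_itv/= in_itv/= !ltW.
Qed.

Section DiagonalExpansion.
Context {R : realType}.
Variables (G : R -> R -> R).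
Hypothesis G_sym : forall s t, G s t = G t s.
Hypotheses (GA : assumptionA G) (GB : assumptionB G) (GC : assumptionC G).

Let D1 := mixed_partial 0 1 G.

Let off (t s : R) : 0 < t < 1 -> 0 < s < 1 -> t != s -> off_diagonal (t, s).
Proof.
move=> /andP[t0 t1] /andP[s0 s1] ts.
by split=> //; rewrite /unit_itv/= in_itv/= !ltW.
Qed.

Let derG (t s : R) : 0 < t < 1 -> 0 < s < 1 -> t != s ->
  is_derive s (1 : R) (G t) (D1 t s).
Proof.
move=> t01 s01 ts; case: GC => _ /(_ 0%N isT t s (off t01 s01 ts)) H _ _.
exact: derivable_on_is_derive (nbhs_unit_itv s01) H.
Qed.

Let derD1 (t s : R) : 0 < t < 1 -> 0 < s < 1 -> t != s ->
  is_derive s (1 : R) (D1 t) (mixed_partial 0 2 G t s).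
Proof.
move=> t01 s01 ts; case: GC => _ /(_ 1%N isT t s (off t01 s01 ts)) H _ _.
exact: derivable_on_is_derive (nbhs_unit_itv s01) H.
Qed.

(** The second derivative in s is bounded off the diagonal, and [a, b] stays on one side of t. The
    constant does not depend on t, which makes the convergence to the one-sided derivatives uniform
    near x. *)
Lemma mixed01_lipschitz : exists2 M : R, 0 <= M &
  forall t a b : R, 0 < t < 1 -> 0 < a -> a <= b -> b < 1 -> (b < t) || (t < a) ->
  `|D1 t b - D1 t a| <= M * (b - a).
Proof.
case: GC => _ _ _ /(_ 0%N 2%N isT)[M HM]; exists `|M| => // t a b t01 a0 ab b1 tab.
have in01 y : a <= y <= b -> 0 < y < 1.
  by move=> /andP[ay yb]; rewrite (lt_le_trans a0 ay) (le_lt_trans yb b1).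
have neq y : a <= y <= b -> t != y.
  move=> /andP[ay yb]; case/orP: tab => [bt|ta].
    by rewrite gt_eqF// (le_lt_trans yb).
  by rewrite lt_eqF// (lt_le_trans ta).
apply: (mvt_norm_le (df := mixed_partial 0 2 G t)) => //.
- move=> y /andP[/ltW ay /ltW yb]; have ayb : a <= y <= b by rewrite ay.
  exact: derD1 t01 (in01 _ ayb) (neq _ ayb).
- apply: (is_derive_within_continuous (df := mixed_partial 0 2 G t)) => y /=.
  by rewrite in_itv/= => ayb; exact: derD1 t01 (in01 _ ayb) (neq _ ayb).
- move=> y /andP[/ltW ay /ltW yb].
  have ayb : a <= y <= b by rewrite ay.
  apply: (@le_trans _ _ M); last exact: ler_norm.
  exact: (HM (t, y) (off t01 (in01 _ ayb) (neq _ ayb))).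
Qed.

(** Each side splits into two errors of size e / 2: by [mixed01_lipschitz], [D1 t s] is within M |t
    - s| of its one-sided limit at s = t, and that limit is continuous in t at x. *)
Lemma mixed01_near_diagonal (x : R) : 0 < x < 1 ->
  forall e : R, 0 < e -> exists2 r : R, 0 < r &
    [/\ 0 < x - r, x + r < 1 &
     forall t s : R, `|t - x| < r -> `|s - x| < r ->
     (s < t -> `|D1 t s - diag_left G x| <= e) /\
     (t < s -> `|D1 t s - diag_right G x| <= e)].
Proof.
move=> /[dup] x01 /andP[x0 x1] e e0.
have [M M0 lipD] := mixed01_lipschitz.
case: GB => -[cvl cvr] [cl cr] _ _.
have e20 : 0 < e / 2 by rewrite divr_gt0.
have xin1 : (`]0, 1] : set R)%classic x by rewrite /= in_itv/= x0 ltW.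
have xin2 : (`[0, 1[ : set R)%classic x by rewrite /= in_itv/= x1 ltW.
have /cvgrPdist_le/(_ _ e20) nl := (subspace_continuousP _ _).1 cl x xin1.
have /cvgrPdist_le/(_ _ e20) nr := (subspace_continuousP _ _).1 cr x xin2.
have {}nl : nbhs x (fun t => (`]0, 1] : set R)%classic t ->
  `|diag_left G x - diag_left G t| <= e / 2) by exact: nl.
have {}nr : nbhs x (fun t => (`[0, 1[ : set R)%classic t ->
  `|diag_right G x - diag_right G t| <= e / 2) by exact: nr.
have [r1 /= r10 H1] := (nbhs_ballP _ _).1 (filterI nl nr).
(* The three bounds on r serve, in order, the continuity of the one-sided limits, the inclusion of
   the neighbourhood in ]0, 1[, and M |t - s| <= 2 r M <= e / 2. *)
pose r := Num.min (Num.min r1 (Num.min x (1 - x) / 2)) (e / (4 * (M + 1))).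
have M1 : 0 < M + 1 by rewrite ltr_wpDl.
have r0 : 0 < r.
  by rewrite !lt_min r10 divr_gt0 ?lt_min ?x0 ?subr_gt0 ?x1//= divr_gt0// mulr_gt0.
have rr1 : r <= r1 by rewrite !ge_min lexx.
have rx : r <= x / 2.
  by rewrite !ge_min ler_pM2r ?invr_gt0// ge_min lexx !orbT.
have rx1 : r <= (1 - x) / 2.
  by rewrite !ge_min ler_pM2r ?invr_gt0// ge_min lexx !orbT.
have rM : r * (4 * (M + 1)) <= e.
  by rewrite -ler_pdivlMr ?mulr_gt0// !ge_min lexx !orbT.
exists r => //.
have xr0 : 0 < x - r by lra.
have xr1 : x + r < 1 by lra.
split=> // t s tx sx.
have t01 : 0 < t < 1 by move: tx; rewrite ltr_norml => /andP[? ?]; apply/andP; split; lra.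
have s01 : 0 < s < 1 by move: sx; rewrite ltr_norml => /andP[? ?]; apply/andP; split; lra.
have xt : ball x r1 t by rewrite /ball/= distrC (lt_le_trans tx).
have [nlt nrt] := H1 t xt.
have {}nlt : `|diag_left G t - diag_left G x| <= e / 2.
  rewrite distrC; apply: nlt; rewrite /= in_itv/=.
  by case/andP: t01 => -> /ltW ->.
have {}nrt : `|diag_right G t - diag_right G x| <= e / 2.
  rewrite distrC; apply: nrt; rewrite /= in_itv/=.
  by case/andP: t01 => /ltW -> ->.
have tsr : `|t - s| <= 2 * r.
  rewrite (_ : t - s = (t - x) - (s - x)); last by ring.
  by rewrite (le_trans (ler_normB _ _))// mulr_natl mulr2n lerD// ltW.
have Mr : M * `|t - s| <= e / 2.
  apply: (@le_trans _ _ ((M + 1) * (2 * r))); last lra.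
  by rewrite ler_pM// lerDl.
split=> st.
  have : `|diag_left G t - D1 t s| <= M * `|t - s|.
    apply: (@lim_dist_le _ t^'- (D1 t)).
      by apply: cvl; rewrite in_itv/=; case/andP: t01 => -> /ltW ->.
    near=> s'.
    have ss' : s < s' by near: s'; exact: nbhs_left_gt.
    have s't : s' < t by near: s'; exact: nbhs_left_lt.
    apply: (@le_trans _ _ (M * (s' - s))).
      apply: lipD => //; last by rewrite s't.
      - by case/andP: s01.
      - exact: ltW.
      - by rewrite (lt_trans s't)//; case/andP: t01.
    by rewrite ler_wpM2l// gtr0_norm ?subr_gt0// lerB// ltW.
  move=> H; rewrite -(subrK (diag_left G t) (D1 t s)) -addrA.
  rewrite (le_trans (ler_normD _ _))// [leRHS]splitr lerD// distrC.
  exact: le_trans Mr.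
have : `|diag_right G t - D1 t s| <= M * `|t - s|.
  apply: (@lim_dist_le _ t^'+ (D1 t)).
    by apply: cvr; rewrite in_itv/=; case/andP: t01 => /ltW -> ->.
  near=> s'.
  have ss' : s' < s by near: s'; exact: nbhs_right_lt.
  have s't : t < s' by near: s'; exact: nbhs_right_gt.
  rewrite distrC; apply: (@le_trans _ _ (M * (s - s'))).
    apply: lipD => //; last by rewrite s't orbT.
    - by rewrite (lt_trans _ s't)//; case/andP: t01.
    - exact: ltW.
    - by case/andP: s01.
  by rewrite ler_wpM2l// distrC gtr0_norm ?subr_gt0// lerB// ltW.
move=> H; rewrite -(subrK (diag_right G t) (D1 t s)) -addrA.
rewrite (le_trans (ler_normD _ _))// [leRHS]splitr lerD// distrC.
exact: le_trans Mr.
Unshelve. all: by end_near. Qed.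

Let contG (t : R) : 0 < t < 1 -> {within unit_itv, continuous (G t)}.
Proof.
move=> /andP[t0 t1]; apply/subspace_continuousP => s s01.
have ut : unit_itv t by rewrite /unit_itv/= in_itv/= !ltW.
have /cvgrPdist_le H := (subspace_continuousP _ _).1 GA (t, s) (conj ut s01).
apply/cvgrPdist_le => e e0; have {}H := H e e0.
have {}H : nbhs (t, s) (fun p => (unit_itv `*` unit_itv) p ->
  `|G t s - G p.1 p.2| <= e) by exact: H.
suff : nbhs s (fun y => unit_itv y -> `|G t s - G t y| <= e) by [].
have [[U V] /= [nU nV] UV] := H.
apply: filterS nV => y Vy uy; apply: (UV (t, y)) => //; split=> //=.
exact: nbhs_singleton nU.
Qed.

(** Write p and q for the left and right derivatives at x. Along the diagonal the slope is p + q;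
    from (t, t) to (t, s) it is p if s < t and q if t < s. For s <= t the linear part (p + q)(t - x)
    - p (t - s) equals (p + q)/2 ((t - x) + (s - x)) - (p - q)/2 (t - s), and symmetrically for t <
    s. The errors add up to e/2 k + e/4 (2 k) = e k. *)
Lemma covariance_diagonal_expansion (x : R) : 0 < x < 1 ->
  forall e : R, 0 < e -> exists2 r : R, 0 < r &
    forall t s k : R, k < r -> `|t - x| <= k -> `|s - x| <= k ->
    `|G t s - (G x x + (diag_left G x + diag_right G x) / 2 * (t - x + (s - x))
               - jump G x / 2 * `|t - s|)| <= e * k.
Proof.
move=> x01 e e0; have e40 : 0 < e / 4 by rewrite divr_gt0.
have [r r0 [xr0 xr1 H]] := mixed01_near_diagonal x01 e40.
set p := diag_left G x in H *; set q := diag_right G x in H *.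
have in01 t : `|t - x| < r -> 0 < t < 1.
  by rewrite ltr_norml => /andP[? ?]; apply/andP; split; lra.
have xx : `|x - x| < r by rewrite subrr normr0.
have contab t a b : `|t - x| < r -> `|a - x| < r -> `|b - x| < r ->
    {within `[a, b], continuous (G t)}.
  move=> tx ax bx; apply: continuous_subspaceW (contG (in01 _ tx)) => y /=.
  move: ax bx; rewrite /unit_itv/= !in_itv/= !ltr_norml.
  by move=> /andP[? ?] /andP[? ?] /andP[? ?]; apply/andP; split; lra.
have left t s : `|t - x| < r -> `|s - x| < r -> s <= t ->
    `|G t t - G t s - p * (t - s)| <= e / 4 * (t - s).
  move=> tx sx st.
  have betw y : s < y < t -> `|y - x| < r.
    move: tx sx; rewrite !ltr_norml.
    by move=> /andP[? ?] /andP[? ?] /andP[? ?]; apply/andP; split; lra.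
  have -> : G t t - G t s - p * (t - s) =
    (G t t - p * t) - (G t s - p * s) by ring.
  apply: (mvt_norm_le (f := fun y => G t y - p * y) (df := fun y => D1 t y - p)) => //.
  - move=> y sy; have yt : t != y by case/andP: sy => _ /gt_eqF ->.
    have Hd := derG (in01 _ tx) (in01 _ (betw _ sy)) yt.
    by apply: is_derive_eq; rewrite /GRing.scale/= mulr1.
  - have cG := contab t s t tx sx tx.
    apply: within_continuousB => //.
    by apply: continuous_subspaceT => y; apply: cvgM; [exact: cvg_cst|exact: cvg_id].
  - move=> y /[dup] /betw yx /andP[_ yt].
    exact: (H t y tx yx).1.
have right t s : `|t - x| < r -> `|s - x| < r -> t <= s ->
    `|G t s - G t t - q * (s - t)| <= e / 4 * (s - t).
  move=> tx sx st.
  have betw y : t < y < s -> `|y - x| < r.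
    move: tx sx; rewrite !ltr_norml.
    by move=> /andP[? ?] /andP[? ?] /andP[? ?]; apply/andP; split; lra.
  have -> : G t s - G t t - q * (s - t) =
    (G t s - q * s) - (G t t - q * t) by ring.
  apply: (mvt_norm_le (f := fun y => G t y - q * y) (df := fun y => D1 t y - q)) => //.
  - move=> y sy; have yt : t != y by case/andP: sy => /lt_eqF ->.
    have Hd := derG (in01 _ tx) (in01 _ (betw _ sy)) yt.
    by apply: is_derive_eq; rewrite /GRing.scale/= mulr1.
  - have cG := contab t t s tx tx sx.
    apply: within_continuousB => //.
    by apply: continuous_subspaceT => y; apply: cvgM; [exact: cvg_cst|exact: cvg_id].
  - move=> y /[dup] /betw yx /andP[yt _].
    exact: (H t y tx yx).2.
(* The path from (x, x) to (t, t) goes through (x, t), which has the same covariance as (t, x): one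
   leg lies on each side of the diagonal, whence the slope p + q. *)
have diag t : `|t - x| < r -> `|G t t - G x x - (p + q) * (t - x)| <= e / 2 * `|t - x|.
  move=> tx; have [xt|tx'] := leP x t.
    have := left t x tx xx xt; have := right x t xx tx xt.
    have t0 : 0 <= t - x by rewrite subr_ge0.
    rewrite (G_sym x t) (ger0_norm t0).
    by rewrite !ler_norml => /andP[? ?] /andP[? ?]; apply/andP; split; lra.
  have := left x t xx tx (ltW tx'); have := right t x tx xx (ltW tx').
  have t0 : t - x < 0 by rewrite subr_lt0.
  rewrite (G_sym x t) (ltr0_norm t0).
  by rewrite !ler_norml => /andP[? ?] /andP[? ?]; apply/andP; split; lra.
exists r => // t s k kr tk sk.
have tx := le_lt_trans tk kr; have sx := le_lt_trans sk kr.
have ek : e / 2 * `|t - x| <= e / 2 * k by rewrite ler_wpM2l// divr_ge0// ltW.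
have tsk : `|t - s| <= k + k.
  rewrite (_ : t - s = (t - x) - (s - x)); last by ring.
  by rewrite (le_trans (ler_normB _ _))// lerD.
have ets : e / 4 * `|t - s| <= e / 4 * (k + k) by rewrite ler_wpM2l// ltW.
have Dt := diag t tx.
rewrite /jump -/p -/q.
have [st|ts] := leP s t.
  have := left t s tx sx st; move: Dt ets.
  have t0 : 0 <= t - s by rewrite subr_ge0.
  rewrite (ger0_norm t0).
  by rewrite !ler_norml => /andP[? ?] ? /andP[? ?]; apply/andP; split; lra.
have := right t s tx sx (ltW ts); move: Dt ets.
have t0 : t - s < 0 by rewrite subr_lt0.
rewrite (ltr0_norm t0).
by rewrite !ler_norml => /andP[? ?] ? /andP[? ?]; apply/andP; split; lra.
Qed.

End DiagonalExpansion.

(** * Antiderivatives and the kernel *)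

Section Antiderivative.
Context {R : realType}.
Notation mu := (@lebesgue_measure R).
Implicit Types k : R -> R.

Lemma integrable_compact_support k : continuous k ->
  (forall u, ~~ (-1 <= u <= 1) -> k u = 0) -> mu.-integrable setT (EFin \o k).
Proof.
move=> ck k0.
have ik : mu.-integrable `[-1, 1] (EFin \o k).
  apply: continuous_compact_integrable; first exact: segment_compact.
  exact: continuous_subspaceT.
have := (integrable_mkcond (mu := mu) (EFin \o k) (measurable_itv _)).1 ik.
apply: eq_integrable => // u _; rewrite patchE mem_setE/= in_itv/=.
by case: ifPn => // /k0 /= ->.
Qed.

Lemma Rintegral_compact_support k (D : set R) : `[-1, 1] `<=` D ->
  (forall u, ~~ (-1 <= u <= 1) -> k u = 0) ->
  \int[mu]_(u in D) k u = \int[mu]_(u in `[-1, 1]) k u.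
Proof.
move=> sD k0; rewrite Rintegral_mkcond [RHS]Rintegral_mkcond.
apply: eq_Rintegral => u _; rewrite !patchE.
have [uI|uI] := boolP (-1 <= u <= 1); last by rewrite k0//; do 2 case: ifP.
have uI' : (`[-1, 1] : set R)%classic u by rewrite /= in_itv.
by rewrite !mem_set//; exact: sD.
Qed.

(** Integrating from minus infinity rather than from -1 gives a derivative at every point of the
    line and an antiderivative that is constant on each side of the support. *)
Lemma compact_support_antiderivative k : continuous k ->
  (forall u, ~~ (-1 <= u <= 1) -> k u = 0) ->
  exists F : R -> R,
    [/\ forall u : R, is_derive u (1 : R) F (k u),
        forall u, u <= -1 -> F u = 0 &
        forall u, 1 <= u -> F u = \int[mu]_(v in `[-1, 1]) k v].
Proof.
move=> ck k0; pose F u := \int[mu]_(v in `]-oo, u]) k v.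
have ik u : mu.-integrable `]-oo, u] (EFin \o k).
  by apply: integrableS (integrable_compact_support ck k0).
exists F; split.
- move=> u; have uu : u < u + 1 by rewrite ltrDl.
  have := continuous_FTC1 uu (ik _) _ (ck u); rewrite ltNyr => /(_ isT)[dF <-].
  by rewrite derive1E; exact/derivableP.
- move=> u u1; rewrite /F.
  (* [k0] says nothing at -1 itself; there the value is 0 as a limit from the left. *)
  have [k1|k1] := eqVneq (k (-1)) 0.
    rewrite (@eq_Rintegral _ _ _ mu _ (cst 0)) ?Rintegral_cst ?mul0r// => v.
    rewrite inE/= in_itv/= => vu; have := le_trans vu u1.
    rewrite le_eqVlt => /predU1P[->//|v1].
    by rewrite k0// negb_and -ltNge v1.
  exfalso; move/negP: k1; apply; apply/eqP.
  apply: (@cvg_unique _ _ (k v @[v --> (-1 : R)^'-])) => //.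
    by apply: cvg_at_left_filter; exact: ck.
  apply: cvg_near_cst; near=> v; apply: k0; rewrite negb_and -ltNge.
  by apply/orP; left; near: v; exact: nbhs_left_lt.
- move=> u u1; apply: Rintegral_compact_support => //.
  by move=> v; rewrite /= !in_itv/= => /andP[_ /le_trans]; apply.
Unshelve. all: by end_near. Qed.

End Antiderivative.

Lemma lipschitz_onP {R : realType} (A : set R) (f : R -> R) :
  [lipschitz f u | u in A] ->
  exists2 L : R, 0 <= L & forall u v, A u -> A v -> `|f u - f v| <= L * `|u - v|.
Proof.
(* The Lipschitz bound is given for all constants beyond M; this one is also nonnegative. *)
move=> [M [_ /(_ (Num.max M 0 + 1))]].
have M1 : M < Num.max M 0 + 1.
  by rewrite (@le_lt_trans _ _ (Num.max M 0)) ?ltrDl// le_max lexx.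
move=> /(_ M1) H; exists (Num.max M 0 + 1).
  by rewrite addr_ge0// le_max lexx orbT.
by move=> u v Au Av; exact: H (u, v) (conj Au Av).
Qed.

Lemma proper_within_dnbhs {R : realType} (A : set R) (x : R) :
  (forall r : R, 0 < r -> exists y : R, [/\ A y, y != x & `|y - x| < r]) ->
  ProperFilter (within A x^').
Proof.
move=> H; apply: Build_ProperFilter_ex => P nP.
have /nbhs_ballP[r /= r0 rP] : nbhs x (fun y => y != x -> A y -> P y) by exact: nP.
have [y [Ay yx xy]] := H r r0; exists y; apply: rP => //.
by rewrite /ball/= distrC.
Qed.

(** The expansion at x, read on the side chosen by s, says |f x + l s t| <= e t for small t > 0.
    Letting t tend to 0 gives f x = 0; dividing by t then gives |l| <= e. *)
Lemma is_derive_eq0_side {R : realType} (f : R -> R) (x l s : R) :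
  `|s| = 1 -> is_derive x (1 : R) f l ->
  (forall t : R, 0 < t -> f (x + s * t) = 0) -> f x = 0 /\ l = 0.
Proof.
move=> s1 df f0.
have s0 : s != 0 by rewrite -normr_eq0 s1 oner_eq0.
have pf : ProperFilter (within setT x^').
  apply: proper_within_dnbhs => r r0; exists (x + r / 2).
  have r2 : 0 < r / 2 by rewrite divr_gt0.
  rewrite -subr_eq0 addrAC subrr add0r gt_eqF// gtr0_norm//; split=> //.
  by rewrite ltr_pdivrMr// mulr_natr mulr2n ltrDl.
have [d1 dl] := derive_on_is_derive pf df.
have H e : 0 < e -> exists2 r, 0 < r & forall t, 0 < t < r -> `|f x + l * (s * t)| <= e * t.
  move=> e0; have := cvg_derive_on d1 e0.
  rewrite dl => /nbhs_ballP[r /= r0 H]; exists r => // t /andP[t0 tr].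
  have st : `|s * t| = t by rewrite normrM s1 mul1r gtr0_norm.
  have xst : x + s * t - x = s * t by rewrite addrAC subrr add0r.
  have tb : ball x r (x + s * t) by rewrite /ball/= distrC xst st.
  have := H _ tb I; rewrite xst st f0// sub0r -opprD normrN; apply.
  by rewrite -subr_eq0 xst -normr_eq0 st gt_eqF.
have fx : f x = 0.
  apply/eqP; rewrite -normr_le0; apply/ler_addgt0Pr => e e0; rewrite add0r.
  have [r r0 {}H] := H 1 ltr01.
  pose t := Num.min (r / 2) (e / (1 + `|l|)).
  have l1 : 0 < 1 + `|l| by rewrite ltr_pwDl.
  have t0 : 0 < t by rewrite lt_min !divr_gt0.
  have tr : t < r by rewrite gt_min; apply/orP; left; lra.
  have te : (1 + `|l|) * t <= e.
    by rewrite mulrC -ler_pdivlMr// ge_min lexx orbT.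
  have := H t; rewrite t0 tr mul1r => /(_ isT) Ht.
  rewrite -[f x](addrK (l * (s * t))) (le_trans (ler_normB _ _))//.
  rewrite !normrM s1 mul1r (gtr0_norm t0); lra.
split=> //; apply/eqP; rewrite -normr_le0; apply/ler_addgt0Pr => e e0; rewrite add0r.
have [r r0 {}H] := H e e0.
have r2 : 0 < r / 2 by rewrite divr_gt0.
have rr : r / 2 < r by lra.
have := H (r / 2); rewrite r2 rr => /(_ isT).
by rewrite fx add0r normrM normrM s1 mul1r (gtr0_norm r2) ler_pM2r.
Qed.

(* The defect on [a, b] of the left-endpoint rule for k, corrected by the first
   two Euler-Maclaurin terms; F is an antiderivative of k and k1 its derivative.
   The corrections telescope when all the cells have the same length. *)
Definition cell_defect {R : realType} (k k1 F : R -> R) (a b : R) : R :=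
  k a * (b - a) - (F b - F a - (b - a) / 2 * (k b - k a)
                   + (b - a) ^+ 2 / 12 * (k1 b - k1 a)).

(** * Local error of the corrected left-endpoint rule *)

Section CellDefect.
Context {R : realType}.
Variables (k k1 k1c k2 F : R -> R) (B L : R).
Hypothesis dF : forall u : R, is_derive u (1 : R) F (k u).
Hypothesis dk : forall u : R, is_derive u (1 : R) k (k1 u).
(** [k1] is the derivative on the line, [k1c] the derivative relative to [-1, 1]. It is [k1c] that
    is differentiated again, with derivative [k2]; the two are compared on [-1, 1] only. *)
Hypothesis k1cE : forall u, -1 <= u <= 1 -> k1c u = k1 u.
Hypothesis dk1 : forall u : R, -1 < u < 1 -> is_derive u (1 : R) k1c (k2 u).
Hypothesis ck1 : {within `[-1, 1], continuous k1c}.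
Hypothesis k2_lip : forall u v, -1 <= u <= 1 -> -1 <= v <= 1 ->
  `|k2 u - k2 v| <= L * `|u - v|.
Hypothesis k1_lip : forall u v, `|k1 u - k1 v| <= B * `|u - v|.
Hypotheses (B0 : 0 <= B) (L0 : 0 <= L).

Let contk : continuous k.
Proof.
by move=> u; apply: differentiable_continuous; apply/derivable1_diffP; case: (dk u).
Qed.

Let contF : continuous F.
Proof.
by move=> u; apply: differentiable_continuous; apply/derivable1_diffP; case: (dF u).
Qed.

(** One integration of a quadratic Taylor estimate: the remainder gains a factor b - a. It is
    applied up the chain from [k2] to [k1], from [k1] to [k] and from [k] to [F]. *)
Let taylor_step (f g : R -> R) (a b c0 c1 c2 C : R) : a <= b ->
  {within `[a, b], continuous f} ->
  (forall t, a < t < b -> is_derive t (1 : R) f (g t)) ->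
  (forall t, a < t < b -> `|g t - c0 - c1 * (t - a) - c2 * (t - a) ^+ 2| <= C) ->
  `|f b - f a - c0 * (b - a) - c1 / 2 * (b - a) ^+ 2 - c2 / 3 * (b - a) ^+ 3|
    <= C * (b - a).
Proof.
move=> ab cf df H.
pose q t := c0 * (t - a) + c1 / 2 * (t - a) ^+ 2 + c2 / 3 * (t - a) ^+ 3.
have dq (t : R) : is_derive t (1 : R) q (c0 + c1 * (t - a) + c2 * (t - a) ^+ 2).
  by apply: is_derive_eq; rewrite /GRing.scale/=; field.
have -> : f b - f a - c0 * (b - a) - c1 / 2 * (b - a) ^+ 2 - c2 / 3 * (b - a) ^+ 3
   = (f b - q b) - (f a - q a) by rewrite /q; ring.
apply: (mvt_norm_le (f := fun t => f t - q t)
  (df := fun t => g t - (c0 + c1 * (t - a) + c2 * (t - a) ^+ 2))) => //.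
- by move=> t tab; have := df t tab => dft; have := dq t => dqt; exact: is_deriveB.
- apply: within_continuousB => //; apply: continuous_subspaceT => t.
  by apply: differentiable_continuous; apply/derivable1_diffP; case: (dq t).
- by move=> t /H; rewrite !opprD !addrA.
Qed.

(** Only the Lipschitz continuity of [k1] enters, so the cell may contain -1 or 1, where the second
    derivative may jump. The three remainders give 1 + 1/2 + 1/12 = 19/12 <= 2. *)
Lemma cell_defect_rough a b : a <= b ->
  `|cell_defect k k1 F a b| <= 2 * B * (b - a) ^+ 3.
Proof.
move=> ab; have d0 : 0 <= b - a by rewrite subr_ge0.
have tk t : a <= t <= b -> `|k t - k a - k1 a * (t - a)| <= B * (b - a) ^+ 2.
  move=> /andP[at_ tb]; have := @taylor_step k k1 a t (k1 a) 0 0 (B * (b - a)) at_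
    (continuous_subspaceT contk) (fun u _ => dk u).
  rewrite !mul0r !subr0 => H; apply: (@le_trans _ _ (B * (b - a) * (t - a))).
    apply: H => u /andP[au ut].
    rewrite !mul0r !subr0 (le_trans (k1_lip _ _))// ler_wpM2l// gtr0_norm ?subr_gt0//.
    by rewrite lerB// (le_trans (ltW ut)).
  by rewrite expr2 mulrA ler_wpM2l ?mulr_ge0// lerB.
have H1 := tk b; rewrite ab lexx in H1; move: (H1 isT) => {}H1.
have H2 : `|F b - F a - k a * (b - a) - k1 a / 2 * (b - a) ^+ 2| <= B * (b - a) ^+ 3.
  have := @taylor_step F k a b (k a) (k1 a) 0 (B * (b - a) ^+ 2) ab
    (continuous_subspaceT contF) (fun u _ => dF u).
  rewrite !mul0r !subr0 -(mulrA B) -exprSr; apply => u /andP[au ub].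
  by rewrite mul0r subr0; apply: tk; rewrite !ltW.
have H3 := k1_lip b a; rewrite (ger0_norm d0) in H3.
set d := b - a in d0 H1 H2 H3 *.
have -> : cell_defect k k1 F a b =
  - (F b - F a - k a * d - k1 a / 2 * d ^+ 2)
  + d / 2 * (k b - k a - k1 a * d) - d ^+ 2 / 12 * (k1 b - k1 a).
  by rewrite /cell_defect -/d; field.
rewrite (le_trans (ler_normB _ _))//.
rewrite (@le_trans _ _ (B * d ^+ 3 + d / 2 * (B * d ^+ 2) + d ^+ 2 / 12 * (B * d)))//.
  have d12 : 0 <= d ^+ 2 / 12 by rewrite divr_ge0// exprn_ge0.
  have d2 : 0 <= d / 2 by rewrite divr_ge0.
  rewrite lerD//; last by rewrite normrM (ger0_norm d12) ler_wpM2l.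
  rewrite (le_trans (ler_normD _ _))// normrN lerD//.
  by rewrite normrM (ger0_norm d2) ler_wpM2l.
have : 0 <= B * d ^+ 3 by rewrite mulr_ge0// exprn_ge0.
by rewrite (_ : B * _ + _ + _ = 19 / 12 * (B * d ^+ 3)); [lra|field].
Qed.

(** Inside the support the expansion goes one order further, and the terms in k2(a) d^3 cancel: -1/6
    + 1/4 - 1/12 = 0. *)
Lemma cell_defect_smooth a b : -1 <= a -> a <= b -> b <= 1 ->
  `|cell_defect k k1 F a b| <= 2 * L * (b - a) ^+ 4.
Proof.
move=> a1 ab b1; have d0 : 0 <= b - a by rewrite subr_ge0.
have inI t : a <= t <= b -> -1 <= t <= 1.
  by move=> /andP[at_ tb]; rewrite (le_trans a1)//= (le_trans tb).
have aI : a <= a <= b by rewrite lexx.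
have bI : a <= b <= b by rewrite lexx ab.
have tk1 t : a <= t <= b -> `|k1 t - k1 a - k2 a * (t - a)| <= L * (b - a) ^+ 2.
  move=> tI; have /andP[at_ tb] := tI.
  have cat : {within `[a, t], continuous k1c}.
    apply: continuous_subspaceW ck1 => u /=; rewrite !in_itv/= => /andP[au ut].
    by rewrite (le_trans a1)//= (le_trans ut)// (le_trans tb).
  have dat u : a < u < t -> is_derive u (1 : R) k1c (k2 u).
    move=> /andP[au ut]; apply: dk1.
    by rewrite (le_lt_trans a1)//= (lt_le_trans ut)// (le_trans tb).
  have := @taylor_step k1c k2 a t (k2 a) 0 0 (L * (b - a)) at_ cat dat.
  rewrite !mul0r !subr0 !k1cE ?inI// => H.
  apply: (@le_trans _ _ (L * (b - a) * (t - a))).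
    apply: H => u /andP[au ut].
    have uI : a <= u <= b by rewrite ltW//= (le_trans (ltW ut)).
    rewrite !mul0r !subr0 (le_trans (k2_lip (inI _ uI) (inI _ aI)))// ler_wpM2l//.
    by rewrite gtr0_norm ?subr_gt0// lerB//; case/andP: uI.
  by rewrite expr2 mulrA ler_wpM2l ?mulr_ge0// lerB.
have tk t : a <= t <= b ->
    `|k t - k a - k1 a * (t - a) - k2 a / 2 * (t - a) ^+ 2| <= L * (b - a) ^+ 3.
  move=> /andP[at_ tb].
  have := @taylor_step k k1 a t (k1 a) (k2 a) 0 (L * (b - a) ^+ 2) at_
    (continuous_subspaceT contk) (fun u _ => dk u).
  rewrite !mul0r !subr0 => H; apply: (@le_trans _ _ (L * (b - a) ^+ 2 * (t - a))).
    apply: H => u /andP[au ut].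
    by rewrite !mul0r !subr0; apply: tk1; rewrite ltW//= (le_trans (ltW ut)).
  have -> : L * (b - a) ^+ 3 = L * (b - a) ^+ 2 * (b - a) by ring.
  by rewrite ler_wpM2l ?mulr_ge0 ?exprn_ge0// lerB.
have H0 := tk1 _ bI; have H1 := tk _ bI.
have H2 : `|F b - F a - k a * (b - a) - k1 a / 2 * (b - a) ^+ 2
    - k2 a / 2 / 3 * (b - a) ^+ 3| <= L * (b - a) ^+ 4.
  have := @taylor_step F k a b (k a) (k1 a) (k2 a / 2) (L * (b - a) ^+ 3) ab
    (continuous_subspaceT contF) (fun u _ => dF u).
  rewrite -(mulrA L) -exprSr; apply => u /andP[au ub].
  by apply: tk; rewrite !ltW.
set d := b - a in d0 H0 H1 H2 *.
have -> : cell_defect k k1 F a b =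
  - (F b - F a - k a * d - k1 a / 2 * d ^+ 2 - k2 a / 2 / 3 * d ^+ 3)
  + d / 2 * (k b - k a - k1 a * d - k2 a / 2 * d ^+ 2)
  - d ^+ 2 / 12 * (k1 b - k1 a - k2 a * d).
  by rewrite /cell_defect -/d; field.
rewrite (le_trans (ler_normB _ _))//.
rewrite (@le_trans _ _ (L * d ^+ 4 + d / 2 * (L * d ^+ 3) + d ^+ 2 / 12 * (L * d ^+ 2)))//.
  have d12 : 0 <= d ^+ 2 / 12 by rewrite divr_ge0// exprn_ge0.
  have d2 : 0 <= d / 2 by rewrite divr_ge0.
  rewrite lerD//; last by rewrite normrM (ger0_norm d12) ler_wpM2l.
  rewrite (le_trans (ler_normD _ _))// normrN lerD//.
  by rewrite normrM (ger0_norm d2) ler_wpM2l.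
have : 0 <= L * d ^+ 4 by rewrite mulr_ge0// exprn_ge0.
by rewrite (_ : L * _ + _ + _ = 19 / 12 * (L * d ^+ 4)); [lra|field].
Qed.

End CellDefect.

(** The interface between the kernel and the sums over the design, with one constant for all bounds.
    [k1] plays the role of the derivative and [F] of the distribution function. The quadratic bounds
    [sk_left] and [sk_right] control the end weights of the trapezoidal rule. *)
Record smooth_kernel {R : realType} (k k1 F : R -> R) (B : R) : Prop := SmoothKernel {
  sk_cst_ge0 : 0 <= B;
  sk_even : forall u : R, k (- u) = k u;
  sk_out : forall u : R, ~~ (-1 < u < 1) -> k u = 0;
  sk_out1 : forall u : R, ~~ (-1 < u < 1) -> k1 u = 0;
  sk_bnd : forall u : R, `|k u| <= B;
  sk_lip : forall u v : R, `|k u - k v| <= B * `|u - v|;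
  sk_lip1 : forall u v : R, `|k1 u - k1 v| <= B * `|u - v|;
  sk_left : forall u : R, -1 <= u -> `|k u| <= B * (u + 1) ^+ 2;
  sk_right : forall u : R, u <= 1 -> `|k u| <= B * (1 - u) ^+ 2;
  sk_antider : forall u : R, is_derive u (1 : R) F (k u);
  sk_F0 : forall u : R, u <= -1 -> F u = 0;
  sk_F1 : forall u : R, 1 <= u -> F u = 1;
  sk_rough : forall a b : R, a <= b -> `|cell_defect k k1 F a b| <= B * (b - a) ^+ 3;
  sk_smooth : forall a b : R, -1 <= a -> a <= b -> b <= 1 ->
    `|cell_defect k k1 F a b| <= B * (b - a) ^+ 4 }.

Section SmoothKernel.
Context {R : realType}.
Variable K : R -> R.
Hypothesis KD : assumptionD K.
Hypothesis Kk : kernel_function K.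

Let A : set R := `[-1, 1].

Let AP (u : R) : A u <-> -1 <= u <= 1.
Proof. by rewrite /A/= in_itv. Qed.

Let dK (u : R) : is_derive u (1 : R) K (derive1 K u).
Proof. by rewrite derive1E; case: KD => _ /(_ u) /derivableP. Qed.

Let K_out (u : R) : ~~ (-1 <= u <= 1) -> K u = 0.
Proof.
move=> uA; apply/eqP/negPn/negP => Ku0; case: Kk => clK _.
have : closure [set u | K u != 0] u by exact: subset_closure.
by rewrite clK/= in_itv/= (negPf uA).
Qed.

Let K_right : K 1 = 0 /\ derive1 K 1 = 0.
Proof.
apply: (is_derive_eq0_side (s := 1) _ (dK 1)); first by rewrite normr1.
by move=> t t0; apply: K_out; rewrite mul1r negb_and -!ltNge ltrDl t0 orbT.
Qed.

Let K_left : K (-1) = 0 /\ derive1 K (-1) = 0.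
Proof.
apply: (is_derive_eq0_side (s := -1) _ (dK (-1))); first by rewrite normrN1.
by move=> t t0; apply: K_out; rewrite mulN1r negb_and -!ltNge gtrDl oppr_lt0 t0.
Qed.

Let K_out' (u : R) : ~~ (-1 < u < 1) -> K u = 0 /\ derive1 K u = 0.
Proof.
move=> uI; have [->|u1] := eqVneq u 1; first exact: K_right.
have [->|uN1] := eqVneq u (-1); first exact: K_left.
have uA : ~~ (-1 <= u <= 1).
  by apply: contra uI; rewrite !lt_neqAle eq_sym uN1 u1.
split; first exact: K_out.
have [u1'|u1'] := ltP 1 u.
  have := is_derive_eq0_side (s := 1) _ (dK u); case; rewrite ?normr1//.
  by move=> t t0; apply: K_out; rewrite mul1r negb_and -!ltNge ltr_wpDr ?orbT// ltW.
have uN : u < -1 by move: uA; rewrite u1' andbT -ltNge.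
have := is_derive_eq0_side (s := -1) _ (dK u); case; rewrite ?normrN1//.
move=> t t0; apply: K_out; rewrite mulN1r negb_and -!ltNge.
by rewrite (lt_trans _ uN)// gtrDl oppr_lt0.
Qed.

Let properA (u : R) : A u -> ProperFilter (within A u^').
Proof.
move=> /AP/andP[uN u1]; apply: proper_within_dnbhs => r r0.
pose t := Num.min (r / 2) 1.
have t0 : 0 < t by rewrite lt_min ltr01 divr_gt0.
have tr : t < r by rewrite gt_min; apply/orP; left; lra.
have t1 : t <= 1 by rewrite ge_min lexx orbT.
have [u0|u0] := leP u 0.
  exists (u + t); split; first by apply/AP/andP; split; lra.
    by rewrite -subr_eq0 addrAC subrr add0r gt_eqF.
  by rewrite addrAC subrr add0r gtr0_norm.
exists (u - t); split; first by apply/AP/andP; split; lra.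
  by rewrite -subr_eq0 addrAC subrr add0r oppr_eq0 gt_eqF.
by rewrite addrAC subrr add0r normrN gtr0_norm.
Qed.

Let K1c (u : R) : -1 <= u <= 1 -> derive_on A K u = derive1 K u.
Proof. by move=> /AP /properA pf; have [] := derive_on_is_derive pf (dK u). Qed.

(** All constants come from B = |K''(0)| + L, which bounds K'' on [-1, 1]. As K' vanishes off ]-1,
    1[, it is B-Lipschitz on the whole line; vanishing at 1 then gives |K'| <= 2B and |K| <= 4B. M =
    4B + 2L also dominates the constants 2B and 2L of the two defect estimates. *)
Lemma smooth_kernel_exists : exists k1 F B, smooth_kernel K k1 F B.
Proof.
case: (KD) => Keven _ [_ dK1 _] /lipschitz_onP[L L0 lipK2].
have {}dK1 (u : R) : -1 <= u <= 1 -> derivable_on A (derive_on A K) u.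
  by move=> /AP uA; apply: dK1; rewrite inE.
have k2_lip (u v : R) : -1 <= u <= 1 -> -1 <= v <= 1 ->
    `|derive_on A (derive_on A K) u - derive_on A (derive_on A K) v| <= L * `|u - v|.
  by move=> /AP Au /AP Av; exact: lipK2.
set k2 := derive_on A (derive_on A K) in k2_lip.
have nA (u : R) : -1 < u < 1 -> nbhs u A.
  move=> uI; have : u \in `]-1, 1[ by rewrite in_itv.
  move=> /near_in_itvoo; apply: filterS => y; rewrite !in_itv/= => /andP[? ?].
  by apply/AP; rewrite !ltW.
have dk1 (u : R) : -1 < u < 1 -> is_derive u (1 : R) (derive_on A K) (k2 u).
  move=> uI; apply: (derivable_on_is_derive (nA _ uI)); apply: dK1.
  by case/andP: uI => /ltW -> /ltW ->.
have ck1 : {within A, continuous (derive_on A K)}.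
  by apply: derivable_on_continuous => u /AP; exact: dK1.
pose B := `|k2 0| + L; have B0 : 0 <= B by rewrite addr_ge0.
have k2B (u : R) : -1 <= u <= 1 -> `|k2 u| <= B.
  move=> uA; have z : -1 <= (0 : R) <= 1 by apply/andP; split; lra.
  have := k2_lip _ _ uA z; rewrite subr0 => H.
  rewrite -(subrK (k2 0) (k2 u)) addrC (le_trans (ler_normD _ _))// lerD//.
  rewrite (le_trans H)// -[leRHS]mulr1 ler_wpM2l// ler_norml.
  by case/andP: uA => -> ->.
have k1lipA (u v : R) : -1 <= u -> u <= v -> v <= 1 ->
    `|derive1 K v - derive1 K u| <= B * (v - u).
  move=> uN uv v1.
  rewrite -!K1c; [|by rewrite uN (le_trans uv)|by rewrite v1 (le_trans uN)].
  apply: (mvt_norm_le (df := k2)) => //.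
  - move=> t /andP[ut tv]; apply: dk1.
    by rewrite (le_lt_trans uN)//= (lt_le_trans tv).
  - apply: continuous_subspaceW ck1 => t /=; rewrite in_itv/= => /andP[ut tv].
    by apply/AP; rewrite (le_trans uN)//= (le_trans tv).
  - move=> t /andP[ut tv]; apply: k2B.
    by rewrite (le_trans uN (ltW ut))/= (le_trans (ltW tv)).
have k1lip' (u v : R) : u <= v -> `|derive1 K v - derive1 K u| <= B * (v - u).
  move=> uv.
  have [vN|vN] := leP v (-1).
    have uN := le_trans uv vN.
    rewrite (K_out' (u := u) _).2 ?negb_and -?leNgt ?uN//.
    rewrite (K_out' (u := v) _).2 ?negb_and -?leNgt ?vN//.
    by rewrite subrr normr0 mulr_ge0// subr_ge0.
  have [u1|u1] := leP 1 u.
    have v1 := le_trans u1 uv.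
    rewrite (K_out' (u := u) _).2 ?negb_and -?leNgt ?u1 ?orbT//.
    rewrite (K_out' (u := v) _).2 ?negb_and -?leNgt ?v1 ?orbT//.
    by rewrite subrr normr0 mulr_ge0// subr_ge0.
  (* Clipping u and v to [-1, 1] leaves K' unchanged, since it vanishes off the support, and can
     only shorten the distance. *)
  pose cu := Num.max (-1) u; pose cv := Num.min 1 v.
  have cuE : derive1 K u = derive1 K cu.
    rewrite /cu; case: leP => // uN; rewrite K_left.2.
    by apply: (K_out' _).2; rewrite negb_and -!leNgt ltW.
  have cvE : derive1 K v = derive1 K cv.
    rewrite /cv; case: leP => // v1; rewrite K_right.2.
    by apply: (K_out' _).2; rewrite negb_and -!leNgt v1 orbT.
  have ucu : u <= cu by rewrite le_max lexx orbT.
  have cvv : cv <= v by rewrite ge_min lexx orbT.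
  rewrite cuE cvE (@le_trans _ _ (B * (cv - cu)))//; last by rewrite ler_wpM2l// lerB.
  apply: k1lipA; rewrite ?le_max ?ge_min ?lexx//.
  by rewrite le_min !ge_max uv (ltW u1) (ltW vN) !andbT; lra.
have k1lip (u v : R) : `|derive1 K u - derive1 K v| <= B * `|u - v|.
  have [uv|uv] := leP u v.
    have vu : 0 <= v - u by rewrite subr_ge0.
    by rewrite distrC (distrC u v) (ger0_norm vu) k1lip'.
  have vu : 0 < u - v by rewrite subr_gt0.
  by rewrite (gtr0_norm vu) k1lip'// ltW.
have k1B (u : R) : `|derive1 K u| <= 2 * B.
  have [uI|/K_out'[_ ->]] := boolP (-1 < u < 1); last by rewrite normr0 mulr_ge0.
  have := k1lip u 1; rewrite K_right.2 subr0 => /le_trans; apply.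
  rewrite mulrC ler_wpM2r// ler_norml; case/andP: uI => ? ?; apply/andP; split; lra.
have contK : continuous K.
  by move=> u; apply: differentiable_continuous; apply/derivable1_diffP; case: (dK u).
have klip' (C u v : R) : u <= v -> (forall t, u < t < v -> `|derive1 K t| <= C) ->
    `|K v - K u| <= C * (v - u).
  move=> uv HC; apply: (mvt_norm_le (df := (derive1 K))) => //.
  exact: continuous_subspaceT.
have klip (u v : R) : `|K u - K v| <= 2 * B * `|u - v|.
  have [uv|uv] := leP u v.
    have vu : 0 <= v - u by rewrite subr_ge0.
    by rewrite distrC (distrC u v) (ger0_norm vu) klip'.
  have vu : 0 < u - v by rewrite subr_gt0.
  by rewrite (gtr0_norm vu) klip'// ltW.
have kB (u : R) : `|K u| <= 4 * B.
  have [uI|/K_out'[-> _]] := boolP (-1 < u < 1); last by rewrite normr0 mulr_ge0.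
  have := klip u 1; rewrite K_right.1 subr0 => /le_trans; apply.
  have -> : 4 * B = 2 * B * 2 by ring.
  rewrite ler_wpM2l ?mulr_ge0// ler_norml; case/andP: uI => ? ?; apply/andP; split; lra.
have [F [dF F0 F1]] := compact_support_antiderivative contK K_out.
have KI : \int[lebesgue_measure]_(v in `[-1, 1]) K v = 1.
  case: Kk => _; apply: etrans; apply/esym.
  exact: Rintegral_compact_support.
pose M := 4 * B + 2 * L.
have M0 : 0 <= M by rewrite addr_ge0// mulr_ge0.
have MB : B <= M by rewrite /M; lra.
have MB2 : 2 * B <= M by rewrite /M; lra.
exists (derive1 K), F, M; split => //.
- by move=> u /K_out'[].
- by move=> u /K_out'[].
- by move=> u; rewrite (le_trans (kB u))// /M; lra.
- by move=> u v; rewrite (le_trans (klip u v))// ler_wpM2r.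
- by move=> u v; rewrite (le_trans (k1lip u v))// ler_wpM2r.
- move=> u u1; have u0 : 0 <= u + 1 by rewrite -lerBlDr sub0r.
  apply: (@le_trans _ _ (B * (u + 1) ^+ 2)); last by rewrite ler_wpM2r// exprn_ge0.
  have := @klip' (B * (u + 1)) _ _ u1; rewrite K_left.1 subr0 opprK expr2 mulrA; apply.
  move=> t /andP[tN tu]; have := k1lip t (-1); rewrite K_left.2 subr0 opprK.
  move=> /le_trans; apply; rewrite ler_wpM2l// ger0_norm; [|lra].
  by rewrite lerD2r ltW.
- move=> u u1; have u0 : 0 <= 1 - u by rewrite subr_ge0.
  apply: (@le_trans _ _ (B * (1 - u) ^+ 2)); last by rewrite ler_wpM2r// exprn_ge0.
  have := @klip' (B * (1 - u)) _ _ u1; rewrite K_right.1 sub0r normrN expr2 mulrA; apply.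
  move=> t /andP[tu t1]; have := k1lip t 1; rewrite K_right.2 subr0.
  move=> /le_trans; apply; rewrite ler_wpM2l// distrC ger0_norm; [|lra].
  by rewrite lerB// ltW.
- by move=> u u1; rewrite F1.
- move=> a b ab; rewrite (le_trans (cell_defect_rough dF dK k1lip B0 ab))//.
  by rewrite ler_wpM2r// exprn_ge0// subr_ge0.
- move=> a b a1 ab b1.
  rewrite (le_trans (cell_defect_smooth dF dK K1c dk1 ck1 k2_lip L0 a1 ab b1))//.
  by rewrite ler_wpM2r ?exprn_ge0 ?subr_ge0// /M; lra.
Qed.

End SmoothKernel.

(** * Density and design *)

Record regular_density {R : realType} (f : R -> R) (c C : R) : Prop := RegularDensity {
  rd_pos : 0 < c;
  rd_cst_ge0 : 0 <= C;
  rd_lo : forall t : R, 0 <= t <= 1 -> c <= f t;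
  rd_lip : forall s t : R, 0 <= s <= 1 -> 0 <= t <= 1 -> `|f s - f t| <= C * `|s - t| }.

(** Index 0 is added to the n design points, with T 0 = 0, so that [0, 1] is cut into n cells.
    [rg_step] says that a cell has length 1 / (n f) up to second order. *)
Record regular_grid {R : realType} (f : R -> R) (c C : R) (n : nat) (T : nat -> R)
    : Prop := RegularGrid {
  rg_in : forall i, (i <= n)%N -> 0 <= T i <= 1;
  rg_first : T 0%N = 0;
  rg_last : T n = 1;
  rg_lt : forall i, (i < n)%N -> T i < T i.+1;
  rg_mesh : forall i, (i < n)%N -> c * (T i.+1 - T i) <= n%:R^-1;
  rg_step : forall i, (i < n)%N ->
    `|f (T i) * (T i.+1 - T i) - n%:R^-1| <= C * (T i.+1 - T i) ^+ 2 }.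

Lemma within_continuous_bounded {R : realType} (f : R -> R) (a b : R) : a <= b ->
  {within `[a, b], continuous f} ->
  exists2 M : R, 0 <= M & forall t, a <= t <= b -> `|f t| <= M.
Proof.
move=> ab cf; have [c _ fc] := EVT_max ab cf; have [d _ fd] := EVT_min ab cf.
exists (`|f c| + `|f d|); first by rewrite addr_ge0.
move=> t tab; have tI : t \in `[a, b] by rewrite in_itv.
rewrite ler_norml; have := fc t tI; have := fd t tI.
have := ler_norm (f c); have := ler_norm (- f d); rewrite normrN.
have := normr_ge0 (f c); have := normr_ge0 (f d).
by move=> ? ? ? ? ? ?; apply/andP; split; lra.
Qed.

Section Design.
Context {R : realType}.
Variable f : R -> R.
Hypothesis fD : density01 f.
Hypothesis fC2 : C2_on unit_itv f.
Notation mu := (@lebesgue_measure R).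

Let contf : {within `[0, 1], continuous f}.
Proof.
by case: fC2 => H _ _; apply: derivable_on_continuous => x xI; apply: H; rewrite inE.
Qed.

Let nbhs01 (t : R) : 0 < t < 1 -> nbhs t (`[0, 1] : set R)%classic.
Proof. exact: nbhs_unit_itv. Qed.

Let intf : mu.-integrable `[0, 1] (EFin \o f).
Proof. by apply: continuous_compact_integrable => //; exact: segment_compact. Qed.

Let F := distribution_function f.

Let contF : {within `[0, 1], continuous F}.
Proof. exact: parameterized_integral_continuous. Qed.

Let derF (t : R) : 0 < t < 1 -> is_derive t (1 : R) F (f t).
Proof.
move=> t01; have /andP[t0 t1] := t01.
have cft : {for t, continuous f}.
  have tI : (`[0, 1] : set R)%classic t by rewrite /= in_itv/= !ltW.
  have H := (subspace_continuousP _ _).1 contf t tI.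
  apply/cvgrPdist_le => e e0; move/cvgrPdist_le : H => /(_ e e0) H.
  have {}H : nbhs t (fun y => (`[0, 1] : set R)%classic y -> `|f t - f y| <= e) by exact: H.
  by apply: filterS2 H (nbhs01 t01) => y Hy; exact: Hy.
have [dF <-] := continuous_FTC1_closed t1 intf t0 cft.
by rewrite derive1E; exact/derivableP.
Qed.

Let mvtF (a b : R) : 0 <= a -> a <= b -> b <= 1 ->
  exists2 t, a <= t <= b & F b - F a = f t * (b - a).
Proof.
move=> a0 ab b1; have := @MVT_segment _ F f a b ab.
case=> [t|| t]; last by rewrite in_itv/=; exists t.
  by rewrite in_itv/= => /andP[? ?]; apply: derF; rewrite (le_lt_trans a0)//= (lt_le_trans _ b1).
apply: continuous_subspaceW contF => t /=; rewrite !in_itv/= => /andP[? ?].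
by rewrite (le_trans a0)//= (le_trans _ b1).
Qed.

Let F0 : F 0 = 0.
Proof. by rewrite /F /distribution_function set_itv1 Rintegral_set1. Qed.

Let F1 : F 1 = 1.
Proof. by case: fD. Qed.

Lemma regular_density_exists : exists c C, regular_density f c C.
Proof.
case: fD => inf0 _ _.
have [dC1 dC2 cf2] := fC2.
have cf1 : {within `[0, 1], continuous (derive_on unit_itv f)}.
  by apply: derivable_on_continuous => x xI; apply: dC2; rewrite inE.
have [M M0 HM] := within_continuous_bounded ler01 cf1.
have [B _ HB] := within_continuous_bounded ler01 contf.
exists (inf (f @` unit_itv)), M; split => //.
- move=> t t01; apply: ge_inf; last by exists t => //; rewrite /unit_itv/= in_itv.
  exists (- B) => _ [u uI <-]; rewrite /unit_itv/= in_itv/= in uI.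
  by have := HB u uI; rewrite ler_norml => /andP[].
- have lip (s t : R) : 0 <= s -> s <= t -> t <= 1 -> `|f t - f s| <= M * (t - s).
    move=> s0 st t1.
    apply: (mvt_norm_le (df := derive_on unit_itv f)) => //.
    + move=> u /andP[su ut]; have u01 : 0 < u < 1.
        by rewrite (le_lt_trans s0)//= (lt_le_trans ut).
      apply: (derivable_on_is_derive (nbhs_unit_itv u01)); apply: dC1.
      by rewrite inE /unit_itv/= in_itv/=; case/andP: u01 => /ltW -> /ltW ->.
    + apply: continuous_subspaceW contf => u /=; rewrite !in_itv/= => /andP[? ?].
      by rewrite (le_trans s0)//= (le_trans _ t1).
    + move=> u /andP[/ltW su /ltW ut]; apply: HM.
      by rewrite (le_trans s0)//= (le_trans ut).
  move=> s t /andP[s0 s1] /andP[t0 t1]; have [st|st] := leP s t.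
    have ts : 0 <= t - s by rewrite subr_ge0.
    by rewrite distrC (distrC s t) (ger0_norm ts) lip.
  have ts : 0 < s - t by rewrite subr_gt0.
  by rewrite (gtr0_norm ts) lip// ltW.
Qed.

(** The intermediate value theorem provides a t with F t = p, and positivity of f makes F strictly
    increasing, so that t is the least element of the set whose infimum defines the quantile. *)
Lemma quantile_distribution (p : R) : (forall t : R, 0 <= t <= 1 -> 0 < f t) ->
  0 <= p <= 1 -> 0 <= quantile f p <= 1 /\ F (quantile f p) = p.
Proof.
move=> fpos p01.
have [|t tI Ft] := @IVT _ F 0 1 p ler01 contF.
  by rewrite F0 F1 minElt maxElt ltr01 p01.
have tI' : 0 <= t <= 1 by rewrite in_itv in tI.
have -> : quantile f p = t; last by [].
have lbt : lbound [set t | unit_itv t /\ p <= F t] t.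
  move=> s [sI ps]; rewrite leNgt; apply/negP => st.
  rewrite /unit_itv/= in_itv/= in sI; case/andP: sI => s0 s1; case/andP: tI' => t0 t1.
  have [u /andP[su ut] E] := mvtF s0 (ltW st) t1.
  have : 0 < F t - F s.
    by rewrite E mulr_gt0 ?subr_gt0// fpos// (le_trans s0)//= (le_trans ut).
  by rewrite Ft subr_gt0 ltNge ps.
have St : [set t | unit_itv t /\ p <= F t] t by split; [|rewrite Ft].
apply/eqP; rewrite eq_le; apply/andP; split.
  by apply: ge_inf => //; exists t.
by apply: lb_le_inf => //; exists t.
Qed.

(** F increases by exactly 1/n over a cell, and the mean value theorem turns this into f u times the
    length, with u in the cell. Bounding f u below gives the mesh; comparing it with f (T i) gives
    the step. *)
Lemma design_point_grid (c C : R) (n : nat) : regular_density f c C -> (0 < n)%N ->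
  regular_grid f c C n (design_point f n).
Proof.
move=> [c0 C0 flo flip] n0.
have fpos (t : R) : 0 <= t <= 1 -> 0 < f t by move=> /flo; exact: lt_le_trans.
have n0' : 0 < n%:R :> R by rewrite ltr0n.
set T := design_point f n.
have TF i : (i <= n)%N -> 0 <= T i <= 1 /\ F (T i) = i%:R / n%:R.
  move=> i_n; apply: quantile_distribution => //.
  by rewrite divr_ge0//= ler_pdivrMr// mul1r ler_nat.
have Tlt i : (i < n)%N -> T i < T i.+1.
  move=> i_n; have [/andP[s0 s1] Fs] := TF _ (ltnW i_n).
  have [/andP[t0 t1] Ft] := TF _ i_n.
  rewrite ltNge; apply/negP => ts; have [u /andP[tu us] E] := mvtF t0 ts s1.
  have : F (T i) - F (T i.+1) < 0.
    by rewrite Fs Ft -mulrBl pmulr_llt0 ?invr_gt0// subr_lt0 ltr_nat.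
  rewrite E; apply/negP; rewrite -leNgt mulr_ge0 ?subr_ge0// ltW// fpos//.
  by rewrite (le_trans t0)//= (le_trans us).
have step i : (i < n)%N -> exists2 u, T i <= u <= T i.+1 &
    n%:R^-1 = f u * (T i.+1 - T i).
  move=> i_n; have [/andP[s0 s1] Fs] := TF _ (ltnW i_n).
  have [/andP[t0 t1] Ft] := TF _ i_n.
  have [u uI E] := mvtF s0 (ltW (Tlt _ i_n)) t1; exists u => //.
  by rewrite -E Fs Ft -mulrBl -[i.+1]addn1 natrD addrAC subrr add0r mul1r.
have in01 i u : (i < n)%N -> T i <= u <= T i.+1 -> 0 <= u <= 1.
  move=> i_n /andP[iu ui]; have [/andP[s0 _] _] := TF _ (ltnW i_n).
  by have [/andP[_ t1] _] := TF _ i_n; rewrite (le_trans s0)//= (le_trans ui).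
split=> //.
- by move=> i /TF[].
- have [/andP[t0 t1]] := TF 0%N (leq0n _); rewrite mul0r => Ft.
  have [u /andP[u0 ut]] := mvtF (lexx 0) t0 t1; rewrite Ft F0 !subr0 => /esym/eqP.
  by rewrite mulf_eq0 gt_eqF ?fpos ?u0//= ?(le_trans ut)// => /eqP.
- have [/andP[t0 t1]] := TF n (leqnn _); rewrite divff ?gt_eqF// => Ft.
  have [u /andP[u0 ut]] := mvtF t0 t1 (lexx 1); rewrite Ft F1 subrr => /esym/eqP.
  by rewrite mulf_eq0 gt_eqF ?fpos ?(le_trans t0)//= subr_eq0 => /eqP.
- move=> i i_n; have [u uI ->] := step i i_n.
  by rewrite ler_wpM2r ?subr_ge0 ?(ltW (Tlt _ i_n))// flo// (in01 i).
- move=> i i_n; have [u uI ->] := step i i_n.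
  have d0 : 0 <= T i.+1 - T i by rewrite subr_ge0 ltW// Tlt.
  have [Ti _] := TF _ (ltnW i_n).
  rewrite -mulrBl normrM (ger0_norm d0) expr2 mulrA ler_wpM2r//.
  rewrite (le_trans (flip _ _ Ti (in01 _ _ i_n uI)))// ler_wpM2l//.
  by case/andP: uI => iu ui; rewrite distrC ger0_norm ?subr_ge0// lerB.
Qed.

End Design.

(** * Sums over the design *)

(* A nondecreasing function of total variation at most 6 whose increments dominate
   both the length of a cell meeting ]-1, 1[ and the number of points -1, 1 that a
   cell contains. *)
Definition sum_weight {R : realType} (u : R) : R :=
  Num.max (-2) (Num.min u 2) + (-1 < u)%R%:R + (1 < u)%R%:R.

Section SumWeight.
Context {R : realType}.
Implicit Types u v : R.

Lemma sum_weight_homo u v : u <= v -> sum_weight u <= sum_weight v.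
Proof.
move=> uv; rewrite /sum_weight; apply: lerD; [apply: lerD|].
- by rewrite le_max2// le_min2.
- by rewrite ler_nat; case: ltP => // u1; rewrite (lt_le_trans u1).
- by rewrite ler_nat; case: ltP => // u1; rewrite (lt_le_trans u1).
Qed.

Lemma sum_weight_variation u v : sum_weight v - sum_weight u <= 6.
Proof.
have lo : -2 <= sum_weight u.
  by rewrite /sum_weight -addrA ler_wpDr ?addr_ge0// le_max lexx.
have hi : sum_weight v <= 4.
  rewrite /sum_weight (_ : 4 = 2 + 1 + 1); last by ring.
  rewrite lerD ?lern1 ?leq_b1// lerD ?lern1 ?leq_b1// ge_max ge_min lexx orbT andbT; lra.
by rewrite lerBlDr (le_trans hi)//; lra.
Qed.

Lemma sum_weight_cell u v : u <= v -> -2 <= u -> v <= 2 ->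
  v - u <= sum_weight v - sum_weight u.
Proof.
move=> uv u2 v2; rewrite /sum_weight.
have -> : Num.max (-2) (Num.min u 2) = u by rewrite min_l ?(le_trans uv)// max_r.
have -> : Num.max (-2) (Num.min v 2) = v by rewrite min_l// max_r ?(le_trans u2).
have h1 : ((-1 < u)%R%:R : R) <= (-1 < v)%R%:R.
  by rewrite ler_nat; case: ltP => // u1; rewrite (lt_le_trans u1).
have h2 : ((1 < u)%R%:R : R) <= (1 < v)%R%:R.
  by rewrite ler_nat; case: ltP => // u1; rewrite (lt_le_trans u1).
lra.
Qed.

Lemma sum_weight_jump u v : u <= v -> (u <= -1 < v) || (u <= 1 < v) ->
  1 <= sum_weight v - sum_weight u.
Proof.
move=> uv; rewrite /sum_weight.
have h0 : Num.max (-2) (Num.min u 2) <= Num.max (-2) (Num.min v 2).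
  by rewrite le_max2// le_min2.
have h1 : ((-1 < u)%R%:R : R) <= (-1 < v)%R%:R.
  by rewrite ler_nat; case: ltP => // u1; rewrite (lt_le_trans u1).
have h2 : ((1 < u)%R%:R : R) <= (1 < v)%R%:R.
  by rewrite ler_nat; case: ltP => // u1; rewrite (lt_le_trans u1).
case/orP => /andP[ue ev].
  by move: h1 h2; rewrite ev (ltNge (-1) u) ue /=; lra.
by move: h1 h2; rewrite ev (ltNge 1 u) ue /=; lra.
Qed.

End SumWeight.

Section GridSums.
Context {R : realType}.
Variables (f : R -> R) (c C : R) (n : nat) (T : nat -> R) (x h : R).
Hypothesis fR : regular_density f c C.
Hypothesis TG : regular_grid f c C n T.
Hypotheses (n0 : (0 < n)%N) (h0 : 0 < h) (x01 : 0 < x < 1).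
Hypotheses (hx : h <= x) (hx1 : h <= 1 - x).

Let eta := (n%:R * h)^-1.
Let u i := (T i - x) / h.
Let d i := u i.+1 - u i.

Hypothesis eta_small : eta <= c.

Let c0 : 0 < c. Proof. by case: fR. Qed.
Let C0 : 0 <= C. Proof. by case: fR. Qed.
Let nR0 : 0 < n%:R :> R. Proof. by rewrite ltr0n. Qed.
Let eta0 : 0 < eta. Proof. by rewrite invr_gt0 mulr_gt0. Qed.

Let TE i : T i = x + h * u i.
Proof. by rewrite /u mulrC divfK ?gt_eqF// addrC subrK. Qed.

Let dE i : T i.+1 - T i = h * d i.
Proof. by rewrite /d !TE; ring. Qed.

Lemma grid_cell_gt0 i : (i < n)%N -> 0 < d i.
Proof.
by move=> /(rg_lt TG); rewrite -subr_gt0 dE pmulr_rgt0.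
Qed.

Lemma grid_cell_mesh i : (i < n)%N -> d i <= c^-1 * eta.
Proof.
move=> /(rg_mesh TG); rewrite dE => H.
by rewrite ler_pdivlMl// /eta invfM ler_pdivlMr// -mulrA (mulrC (d i)).
Qed.

Lemma grid_cell_le1 i : (i < n)%N -> d i <= 1.
Proof.
move=> /grid_cell_mesh /le_trans; apply.
by rewrite mulrC ler_pdivrMr// mul1r.
Qed.

Lemma grid_start : u 0%N <= -1.
Proof. by rewrite /u (rg_first TG) sub0r mulNr lerN2 ler_pdivlMr// mul1r. Qed.

Lemma grid_end : 1 <= u n.
Proof. by rewrite /u (rg_last TG) ler_pdivlMr// mul1r. Qed.

Definition touching i := (u i < 1) && (-1 < u i.+1).

Lemma touching_bounds i : (i < n)%N -> touching i -> -2 <= u i /\ u i.+1 <= 2.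
Proof.
move=> i_n /andP[ui1 ui]; have := grid_cell_le1 i_n; rewrite /d => dle.
by split; lra.
Qed.

Lemma grid_cell_step i : (i < n)%N -> `|f (T i) * d i - eta| <= C * h * d i ^+ 2.
Proof.
move=> /(rg_step TG); rewrite dE => H; rewrite -(ler_pM2l h0).
rewrite -{1}(gtr0_norm h0) -normrM.
have -> : h * (f (T i) * d i - eta) = f (T i) * (h * d i) - n%:R^-1.
  by rewrite /eta; field; rewrite !gt_eqF.
by rewrite (le_trans H)// exprMn (_ : C * _ = h * (C * h * d i ^+ 2))//; ring.
Qed.

(** A touching cell starts within 2h of x, so replacing f (T i) by f x costs 2 C h d;
    [grid_cell_step] adds C h d^2 <= C h d. Hence the factor 3. *)
Lemma grid_cell_uniform i : (i < n)%N -> touching i ->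
  `|d i - eta / f x| <= 3 * C / c ^+ 2 * (h * eta).
Proof.
move=> i_n ti; have [u2 u2'] := touching_bounds i_n ti.
have di := grid_cell_gt0 i_n; have dm := grid_cell_mesh i_n; have d1 := grid_cell_le1 i_n.
have xI : 0 <= x <= 1 by case/andP: x01 => /ltW -> /ltW ->.
have fx := rd_lo fR xI.
have fx0 : 0 < f x by rewrite (lt_le_trans c0).
have H1 : `|f x * d i - eta| <= 3 * C * h * d i.
  have TI : 0 <= T i <= 1 by apply: (rg_in TG); rewrite ltnW.
  have H2 := rd_lip fR xI TI.
  have ui2 : `|x - T i| <= h * 2.
    rewrite TE opprD addrA subrr sub0r normrN normrM (gtr0_norm h0) ler_pM2l//.
    by rewrite ler_norml u2/=; move: u2' di; rewrite /d; lra.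
  have {}H2 : `|f x - f (T i)| <= C * (h * 2) by rewrite (le_trans H2)// ler_wpM2l.
  rewrite (_ : f x * d i - eta = (f x - f (T i)) * d i + (f (T i) * d i - eta)); last by ring.
  rewrite (le_trans (ler_normD _ _))// normrM (gtr0_norm di).
  rewrite (@le_trans _ _ (C * (h * 2) * d i + C * h * d i ^+ 2))//.
    by rewrite lerD ?grid_cell_step// ler_wpM2r// ltW.
  rewrite (_ : 3 * C * h * d i = C * (h * 2) * d i + C * h * d i); last by ring.
  by rewrite lerD2l ler_wpM2l ?mulr_ge0 ?(ltW h0)// expr2 ler_piMr// ltW.
rewrite -(ler_pM2l fx0) -{1}(gtr0_norm fx0) -normrM.
have -> : f x * (d i - eta / f x) = f x * d i - eta by field; rewrite gt_eqF.
rewrite (le_trans H1)// (@le_trans _ _ (3 * C * h * (c^-1 * eta)))//.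
  by rewrite ler_wpM2l// !mulr_ge0// ltW.
rewrite (@le_trans _ _ (c * (3 * C / c ^+ 2 * (h * eta))))//.
  by rewrite (_ : c * _ = 3 * C * h * (c^-1 * eta))//; field; rewrite gt_eqF.
rewrite ler_wpM2r// mulr_ge0 ?divr_ge0 ?mulr_ge0 ?exprn_ge0// ltW//.
Qed.

Let w i := sum_weight (u i.+1) - sum_weight (u i).

Let u_le i : (i < n)%N -> u i <= u i.+1.
Proof. by move=> /grid_cell_gt0; rewrite subr_gt0 => /ltW. Qed.

Let w_ge0 i : (i < n)%N -> 0 <= w i.
Proof. by move=> i_n; rewrite subr_ge0 sum_weight_homo// u_le. Qed.

Lemma touching_weight i : (i < n)%N -> touching i -> d i <= w i.
Proof.
by move=> i_n /touching_bounds -/(_ i_n)[? ?]; apply: sum_weight_cell => //; exact: u_le.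
Qed.

(** The increments [w i] telescope to the variation of [sum_weight] between the ends of the grid,
    which is at most 6 whatever the number of cells. *)
Lemma sum_norm_weight (a : nat -> R) (E : R) : 0 <= E ->
  (forall i, (i < n)%N -> `|a i| <= E * w i) -> \sum_(i < n) `|a i| <= 6 * E.
Proof.
move=> E0 H; rewrite (@le_trans _ _ (\sum_(i < n) E * w i))//.
  by apply: ler_sum => i _; exact: H.
rewrite -mulr_sumr mulrC ler_wpM2r//.
have -> : \sum_(i < n) w i = sum_weight (u n) - sum_weight (u 0%N).
  by rewrite -(big_mkord xpredT w) telescope_sumr.
exact: sum_weight_variation.
Qed.

Lemma sum_touching (a : nat -> R) (E : R) : 0 <= E ->
  (forall i, (i < n)%N -> touching i -> `|a i| <= E * d i) ->
  (forall i, (i < n)%N -> ~~ touching i -> a i = 0) ->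
  \sum_(i < n) `|a i| <= 6 * E.
Proof.
move=> E0 H1 H2; apply: sum_norm_weight => // i i_n.
have [ti|ti] := boolP (touching i); last by rewrite H2// normr0 mulr_ge0// w_ge0.
by rewrite (le_trans (H1 _ i_n ti))// ler_wpM2l// touching_weight.
Qed.

Let not_touching i : (i < n)%N -> ~~ touching i ->
  u i <= -1 /\ u i.+1 <= -1 \/ 1 <= u i /\ 1 <= u i.+1.
Proof.
move=> i_n; rewrite negb_and -!leNgt => /orP[ui|ui]; [right|left]; split=> //.
  by rewrite (le_trans ui)// u_le.
by rewrite (le_trans _ ui)// u_le.
Qed.

Let out_of_support (v : R) : v <= -1 \/ 1 <= v -> ~~ (-1 < v < 1).
Proof. by rewrite negb_and -!leNgt => -[->//|->]; rewrite orbT. Qed.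

(** The integral is a telescoping sum of increments of an antiderivative, because the grid covers
    [-1, 1]. On each cell the error is at most M d^2, and one factor d is bounded by eta / c. *)
Lemma riemann_sum_error (k : R -> R) (M : R) : 0 <= M ->
  (forall v, ~~ (-1 < v < 1) -> k v = 0) ->
  (forall v v', `|k v - k v'| <= M * `|v - v'|) ->
  `|\sum_(i < n) k (u i) * d i - \int[lebesgue_measure]_(v in `[-1, 1]) k v|
    <= 6 * (M / c) * eta.
Proof.
move=> M0 k0 klip.
have ck : continuous k.
  move=> v; apply/cvgrPdist_le => e e0.
  have M1 : 0 < M + 1 by rewrite ltr_wpDl.
  apply/nbhs_ballP; exists (e / (M + 1)); first by rewrite /= divr_gt0.
  move=> v' /=; rewrite /ball/= => vv'; rewrite (le_trans (klip _ _))//.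
  rewrite (@le_trans _ _ ((M + 1) * `|v - v'|))//; first by rewrite ler_wpM2r// lerDl.
  by rewrite mulrC -ler_pdivlMr// ltW.
have [v vI|Phi [dPhi P0 P1]] := compact_support_antiderivative ck.
  by apply: k0; apply: contra vI => /andP[/ltW -> /ltW ->].
have -> : \int[lebesgue_measure]_(v in `[-1, 1]) k v =
    \sum_(i < n) (Phi (u i.+1) - Phi (u i)).
  rewrite -(big_mkord xpredT (fun i => Phi (u i.+1) - Phi (u i))).
  rewrite (telescope_sumr (fun i => Phi (u i)) (leq0n n)).
  by rewrite (P0 (u 0%N) grid_start) subr0 (P1 (u n) grid_end).
rewrite -sumrB.
rewrite (le_trans (ler_norm_sum _ _ _))// -mulrA.
apply: (@sum_touching (fun i => k (u i) * d i - (Phi (u i.+1) - Phi (u i)))).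
- by rewrite mulr_ge0 ?divr_ge0// ltW.
- move=> i i_n _; have di := grid_cell_gt0 i_n.
  have ui := u_le i_n.
  have -> : k (u i) * d i - (Phi (u i.+1) - Phi (u i)) =
      - ((Phi (u i.+1) - k (u i) * u i.+1) - (Phi (u i) - k (u i) * u i)).
    by rewrite /d; ring.
  rewrite normrN (@le_trans _ _ (M * d i * d i))//; last first.
    rewrite ler_wpM2r ?(ltW di)// -mulrA ler_wpM2l//; exact: grid_cell_mesh.
  apply: (mvt_norm_le (f := fun t => Phi t - k (u i) * t)
    (df := fun t => k t - k (u i))) => //.
  + by move=> t _; apply: is_derive_eq; rewrite /GRing.scale/= mulr1.
  + apply: (is_derive_within_continuous (df := fun t => k t - k (u i))) => t _.
    by apply: is_derive_eq; rewrite /GRing.scale/= mulr1.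
  + move=> t /andP[ut tu]; rewrite (le_trans (klip _ _))// ler_wpM2l//.
    by rewrite gtr0_norm ?subr_gt0// lerB// ltW.
- move=> i i_n /not_touching -/(_ i_n)[[ui ui1]|[ui ui1]].
    by rewrite !P0// k0 ?mul0r ?subrr//; apply: out_of_support; left.
  by rewrite !P1// k0 ?mul0r ?subrr//; apply: out_of_support; right.
Qed.

Variables (K K1 F : R -> R) (B : R).
Hypothesis sK : smooth_kernel K K1 F B.

Let B0 : 0 <= B. Proof. by case: sK. Qed.

Let K_nt i : (i < n)%N -> ~~ touching i ->
  [/\ K (u i) = 0, K (u i.+1) = 0, K1 (u i) = 0 & K1 (u i.+1) = 0].
Proof.
move=> i_n /not_touching -/(_ i_n) H.
have h1 : ~~ (-1 < u i < 1) by apply: out_of_support; case: H => -[]; [left|right].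
have h2 : ~~ (-1 < u i.+1 < 1) by apply: out_of_support; case: H => -[]; [left|right].
by rewrite (sk_out sK h1) (sk_out sK h2) (sk_out1 sK h1) (sk_out1 sK h2).
Qed.

Lemma kernel_sum_norm : \sum_(i < n) `|K (u i) * d i| <= 6 * B.
Proof.
apply: (@sum_touching (fun i => K (u i) * d i)) => // [i i_n _|i i_n ti].
  have di := grid_cell_gt0 i_n.
  by rewrite normrM (gtr0_norm di) ler_wpM2r ?(ltW di)// (sk_bnd sK).
by have [-> _ _ _] := K_nt i_n ti; rewrite mul0r.
Qed.

(** A cell containing -1 or 1 pays the cubic bound, covered by a jump of [sum_weight]; any other
    touching cell pays the quartic one, and its extra factor d is covered by the linear part of
    [sum_weight]. *)
Let defect_sum : \sum_(i < n) `|cell_defect K K1 F (u i) (u i.+1)|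
  <= 6 * (B / c ^+ 3 * eta ^+ 3).
Proof.
have E0 : 0 <= B / c ^+ 3 * eta ^+ 3.
  by apply: mulr_ge0; [apply: divr_ge0 => //|]; apply: exprn_ge0; exact: ltW.
apply: (@sum_norm_weight (fun i => cell_defect K K1 F (u i) (u i.+1))).
  exact: E0.
move=> i i_n.
have di := grid_cell_gt0 i_n; have dm := grid_cell_mesh i_n; have d1 := grid_cell_le1 i_n.
have ui := u_le i_n.
have d3 : d i ^+ 3 <= (c ^+ 3)^-1 * eta ^+ 3.
  by rewrite -exprVn -exprMn lerXn2r// ?nnegrE ?ltW// mulr_gt0// invr_gt0.
have E3 : B * d i ^+ 3 <= B / c ^+ 3 * eta ^+ 3 by rewrite -mulrA ler_wpM2l.
have [ti|ti] := boolP (touching i); last first.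
  have [k0 k1 k10 k11] := K_nt i_n ti.
  rewrite /cell_defect k0 k1 k10 k11 !subrr !mulr0 mul0r !addr0 subr0.
  have [[ui' ui1]|[ui' ui1]] := not_touching i_n ti.
    by rewrite !(sk_F0 sK)// subrr subr0 normr0 mulr_ge0// w_ge0.
  by rewrite !(sk_F1 sK)// subrr subr0 normr0 mulr_ge0// w_ge0.
have [bad|good] := boolP ((u i <= -1 < u i.+1) || (u i <= 1 < u i.+1)).
  rewrite (le_trans (sk_rough sK ui))// (le_trans E3)// -[leLHS]mulr1 ler_wpM2l//.
  exact: sum_weight_jump.
have /andP[ti1 ti2] := ti.
have uiN : -1 <= u i.
  by rewrite leNgt; apply/negP => /ltW uiN; move: good; rewrite uiN ti2.
have ui1 : u i.+1 <= 1.
  by rewrite leNgt; apply/negP => ui1; move: good; rewrite (ltW ti1) ui1 orbT.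
rewrite (le_trans (sk_smooth sK uiN ui ui1))// -/(d i) exprSr mulrA.
rewrite (@le_trans _ _ (B / c ^+ 3 * eta ^+ 3 * d i))//.
  by rewrite ler_wpM2r// ltW.
by rewrite ler_wpM2l// touching_weight.
Qed.

(* Euler-Maclaurin: the boundary terms telescope to 0 up to the nonuniformity of
   the grid, which is of relative order h. *)
Lemma kernel_sum_error :
  `|\sum_(i < n) K (u i) * d i - 1|
    <= 6 * (B / c ^+ 3) * eta ^+ 3 + 12 * (B * (3 * C / c ^+ 2)) * (h * eta).
Proof.
(* The common length that the cells would have for a constant density f x. With [d0] in place of
   [d i] the corrections telescope to 0, leaving only the differences d - d0 and d^2 - d0^2. *)
pose d0 := eta / f x.
have xI : 0 <= x <= 1 by case/andP: x01 => /ltW -> /ltW ->.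
have fx := rd_lo fR xI.
have fx0 : 0 < f x by rewrite (lt_le_trans c0).
have d00 : 0 <= d0 by rewrite divr_ge0 ?ltW.
have d01 : d0 <= 1 by rewrite ler_pdivrMr// mul1r (le_trans eta_small).
have tele (g : R -> R) : \sum_(i < n) (g (u i.+1) - g (u i)) = g (u n) - g (u 0%N).
  by rewrite -(big_mkord xpredT (fun i => g (u i.+1) - g (u i)))
    (telescope_sumr (fun i => g (u i))).
have K0 : \sum_(i < n) (K (u i.+1) - K (u i)) = 0.
  rewrite tele !(sk_out sK) ?subrr//; apply: out_of_support.
    by left; exact: grid_start.
  by right; exact: grid_end.
have K10 : \sum_(i < n) (K1 (u i.+1) - K1 (u i)) = 0.
  rewrite tele !(sk_out1 sK) ?subrr//; apply: out_of_support.
    by left; exact: grid_start.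
  by right; exact: grid_end.
have F10 : \sum_(i < n) (F (u i.+1) - F (u i)) = 1.
  by rewrite tele (sk_F0 sK grid_start) (sk_F1 sK grid_end) subr0.
have -> : \sum_(i < n) K (u i) * d i - 1 =
    \sum_(i < n) cell_defect K K1 F (u i) (u i.+1)
  - \sum_(i < n) (d i - d0) / 2 * (K (u i.+1) - K (u i))
  + \sum_(i < n) (d i ^+ 2 - d0 ^+ 2) / 12 * (K1 (u i.+1) - K1 (u i)).
  have -> : \sum_(i < n) K (u i) * d i =
      \sum_(i < n) cell_defect K K1 F (u i) (u i.+1)
    + \sum_(i < n) (F (u i.+1) - F (u i))
    - \sum_(i < n) (d i - d0) / 2 * (K (u i.+1) - K (u i))
    + \sum_(i < n) (d i ^+ 2 - d0 ^+ 2) / 12 * (K1 (u i.+1) - K1 (u i))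
    - d0 / 2 * \sum_(i < n) (K (u i.+1) - K (u i))
    + d0 ^+ 2 / 12 * \sum_(i < n) (K1 (u i.+1) - K1 (u i)).
    rewrite !mulr_sumr -big_split -sumrB -big_split -sumrB -big_split/=.
    by apply: eq_bigr => i _; rewrite /cell_defect /d; field.
  by rewrite F10 K0 K10 !mulr0; ring.
pose E := 3 * C / c ^+ 2 * (h * eta).
have E0 : 0 <= E.
  apply: mulr_ge0; last by rewrite mulr_ge0// ltW.
  by apply: divr_ge0; [rewrite mulr_ge0|apply: exprn_ge0; exact: ltW].
have S2 : \sum_(i < n) `|(d i - d0) / 2 * (K (u i.+1) - K (u i))| <= 6 * (B * E).
  apply: (@sum_touching (fun i => (d i - d0) / 2 * (K (u i.+1) - K (u i)))).
  - by rewrite mulr_ge0.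
  - move=> i i_n ti; have di := grid_cell_gt0 i_n.
    have H := grid_cell_uniform i_n ti; have HK := sk_lip sK (u i.+1) (u i).
    rewrite -/(d i) (gtr0_norm di) in HK.
    have H2 : `|(d i - d0) / 2| <= E.
      by rewrite normrM (le_trans _ H)// ler_piMr// ger0_norm ?invr_ge0// invf_le1// ler1n.
    rewrite normrM (_ : B * E * d i = E * (B * d i)); last by ring.
    by rewrite ler_pM.
  - by move=> i i_n ti; have [-> -> _ _] := K_nt i_n ti; rewrite subrr mulr0.
have S3 : \sum_(i < n) `|(d i ^+ 2 - d0 ^+ 2) / 12 * (K1 (u i.+1) - K1 (u i))|
    <= 6 * (B * E).
  apply: (@sum_touching (fun i => (d i ^+ 2 - d0 ^+ 2) / 12 * (K1 (u i.+1) - K1 (u i)))).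
  - by rewrite mulr_ge0.
  - move=> i i_n ti; have di := grid_cell_gt0 i_n; have d1 := grid_cell_le1 i_n.
    have H := grid_cell_uniform i_n ti; have HK := sk_lip1 sK (u i.+1) (u i).
    rewrite -/(d i) (gtr0_norm di) in HK.
    have H2 : `|(d i ^+ 2 - d0 ^+ 2) / 12| <= E.
      rewrite (_ : _ / 12 = (d i - d0) * ((d i + d0) / 12)); last by field.
      have dd0 : 0 <= (d i + d0) / 12 by rewrite divr_ge0// addr_ge0// ltW.
      rewrite normrM (le_trans _ H)// ler_piMr// (ger0_norm dd0) ler_pdivrMr// mul1r.
      by rewrite (le_trans (lerD d1 d01))//; lra.
    rewrite normrM (_ : B * E * d i = E * (B * d i)); last by ring.
    by rewrite ler_pM.
  - by move=> i i_n ti; have [_ _ -> ->] := K_nt i_n ti; rewrite subrr mulr0.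
rewrite (le_trans (ler_normD _ _))//.
rewrite (_ : 6 * (B / c ^+ 3) * eta ^+ 3 + _ =
  6 * (B / c ^+ 3 * eta ^+ 3) + 6 * (B * E) + 6 * (B * E)); last first.
  by rewrite /E; field; rewrite gt_eqF.
rewrite lerD ?(le_trans (ler_norm_sum _ _ _))//.
rewrite (le_trans (ler_normB _ _))// lerD ?(le_trans (ler_norm_sum _ _ _))//.
Qed.

End GridSums.

(** * First moment and potential of the kernel *)

Section KernelMoments.
Context {R : realType}.
Variables (K K1 F : R -> R) (B : R).
Hypothesis sK : smooth_kernel K K1 F B.
Notation mu := (@lebesgue_measure R).

Let B0 : 0 <= B. Proof. by case: sK. Qed.

Lemma kernel_mul_lipschitz (psi : R -> R) (L N : R) :
  (forall v v', `|psi v - psi v'| <= L * `|v - v'|) ->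
  (forall v, -1 <= v <= 1 -> `|psi v| <= N) ->
  forall v v', `|K v * psi v - K v' * psi v'| <= (B * L + B * N) * `|v - v'|.
Proof.
move=> psiL psiN.
have z : -1 <= (0 : R) <= 1 by apply/andP; split; lra.
have N0 : 0 <= N by rewrite (le_trans _ (psiN 0 z)).
have L0 : 0 <= L.
  by have := le_trans (normr_ge0 _) (psiL 1 0); rewrite subr0 normr1 mulr1.
(* One of the two points may be taken in ]-1, 1[, as otherwise both products vanish; [psi] is then
   bounded only at that point. *)
have main v v' : -1 < v' < 1 ->
    `|K v * psi v - K v' * psi v'| <= (B * L + B * N) * `|v - v'|.
  move=> /andP[v1 v2].
  rewrite (_ : _ - _ = K v * (psi v - psi v') + (K v - K v') * psi v'); last by ring.
  rewrite (le_trans (ler_normD _ _))// [leRHS]mulrDl !normrM lerD//.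
    by rewrite -mulrA ler_pM// ?(sk_bnd sK).
  rewrite (_ : B * N * _ = B * `|v - v'| * N); last by ring.
  by rewrite ler_pM// ?(sk_lip sK)// psiN// !ltW.
move=> v v'; have [v'I|v'O] := boolP (-1 < v' < 1); first exact: main.
have [vI|vO] := boolP (-1 < v < 1); first by rewrite distrC (distrC v); exact: main.
rewrite (sk_out sK vO) (sk_out sK v'O) !mul0r subrr normr0 mulr_ge0//.
by rewrite addr_ge0// mulr_ge0.
Qed.

Let contK : continuous K.
Proof.
move=> v; apply/cvgrPdist_le => e e0.
have M1 : 0 < B + 1 by rewrite ltr_wpDl.
apply/nbhs_ballP; exists (e / (B + 1)); first by rewrite /= divr_gt0.
move=> v' /=; rewrite /ball/= => vv'; rewrite (le_trans (sk_lip sK _ _))//.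
rewrite (@le_trans _ _ ((B + 1) * `|v - v'|))//; first by rewrite ler_wpM2r// lerDl.
by rewrite mulrC -ler_pdivlMr// ltW.
Qed.

Let K_out_ge (u : R) : ~~ (-1 <= u <= 1) -> K u = 0.
Proof.
by move=> uI; apply: (sk_out sK); apply: contra uI => /andP[/ltW -> /ltW ->].
Qed.

(** As v K(v) is odd, Phi(t) - Phi(-t) has derivative 0; it is 0 at t = 0 and the integral at t =
    1. *)
Lemma kernel_first_moment : \int[mu]_(v in `[-1, 1]) (K v * v) = 0.
Proof.
have ck : continuous (fun v => K v * v).
  by move=> v; apply: cvgM; [exact: contK|exact: cvg_id].
have [v vI|Phi [dPhi P0 P1]] := compact_support_antiderivative ck.
  by rewrite K_out_ge ?mul0r.
rewrite -(P1 1 (lexx _)).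
have : Phi 1 - Phi (- 1) = Phi 0 - Phi (- 0).
  apply: (@is_derive_0_is_cst _ (fun t => Phi t - Phi (- t))) => t.
  have H := dPhi (- t); have H' := dPhi t.
  have Hc : is_derive t (1 : R) (Phi \o -%R) (K (- t) * (- t) * (-1)).
    by apply: is_derive1_comp.
  have := is_deriveB H' Hc; rewrite (sk_even sK) => Hd.
  by apply: (is_derive_eq Hd); ring.
by rewrite oppr0 subrr (P0 (- 1))// subr0.
Qed.

(** The convolution of K with the absolute value. It isolates the inner integral of [kernel_C], so
    that the double sum is compared with it one index at a time. *)
Definition kernel_potential (w : R) : R :=
  \int[mu]_(v in `[-1, 1]) (`|w - v| * K v).

Let integrable_itv (g : R -> R) : continuous g -> mu.-integrable `[-1, 1] (EFin \o g).
Proof.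
move=> cg; apply: continuous_compact_integrable; first exact: segment_compact.
exact: continuous_subspaceT.
Qed.

Let cont_potential (w : R) : continuous (fun v => `|w - v| * K v).
Proof.
move=> v; apply: cvgM; last exact: contK.
by apply: cvg_norm; apply: cvgB; [exact: cvg_cst|exact: cvg_id].
Qed.

Lemma kernel_potential_lipschitz (w w' : R) :
  `|kernel_potential w - kernel_potential w'| <= 2 * B * `|w - w'|.
Proof.
rewrite /kernel_potential -RintegralB//; [|exact: integrable_itv..].
have cd : continuous (fun v => `|w - v| * K v - `|w' - v| * K v).
  by move=> v; apply: cvgB; exact: cont_potential.
rewrite (le_trans (le_normr_Rintegral _ _))//; first exact: integrable_itv.
have cn : continuous (fun v => `| `|w - v| * K v - `|w' - v| * K v |).
  by move=> v; apply: cvg_norm; exact: cd.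
rewrite (@le_trans _ _ (\int[mu]_(v in `[-1, 1]) (B * `|w - w'|)))//.
  apply: le_Rintegral => //; [exact: integrable_itv| |].
    by apply: integrable_itv => v; exact: cvg_cst.
  move=> v _; rewrite -mulrBl normrM mulrC ler_pM// ?(sk_bnd sK)//.
  by rewrite (le_trans (ler_dist_dist _ _))// (_ : w - v - (w' - v) = w - w')//; ring.
rewrite Rintegral_cst//.
rewrite [X in fine X](_ : _ = 2%:E); first by rewrite /= mulrC mulrA.
apply: etrans (lebesgue_measure_itv (R := R) `[-1, 1]) _.
rewrite /= lte_fin (_ : -1 < 1); last by lra.
by rewrite -EFinB opprK.
Qed.

Lemma kernel_C_potential :
  kernel_C K = \int[mu]_(u in `[-1, 1]) (K u * kernel_potential u).
Proof.
apply: eq_Rintegral => u _; rewrite /kernel_potential -RintegralZl//.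
  by apply: eq_Rintegral => v _; ring.
exact: integrable_itv.
Qed.

End KernelMoments.

(** * Total weight, first moment and double sum of the weights *)

Section WeightedSums.
Context {R : realType}.
Variables (f K K1 F : R -> R) (c C B : R) (n : nat) (T : nat -> R) (x h : R).
Hypothesis sK : smooth_kernel K K1 F B.
Hypothesis fR : regular_density f c C.
Hypothesis TG : regular_grid f c C n T.
Hypotheses (n0 : (0 < n)%N) (h0 : 0 < h) (x01 : 0 < x < 1).
Hypotheses (hx : h <= x) (hx1 : h <= 1 - x).

Let eta := (n%:R * h)^-1.
Let u i := (T i - x) / h.
Let d i := u i.+1 - u i.

Hypothesis eta_small : eta <= c.

Let B0 : 0 <= B. Proof. by case: sK. Qed.
Let c0 : 0 < c. Proof. by case: fR. Qed.
Let C0 : 0 <= C. Proof. by case: fR. Qed.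
Let nR0 : 0 < n%:R :> R. Proof. by rewrite ltr0n. Qed.
Let eta0 : 0 < eta. Proof. by rewrite invr_gt0 mulr_gt0. Qed.
Let d_gt0 i : (i < n)%N -> 0 < d i.
Proof. exact: (grid_cell_gt0 x TG h0). Qed.
Let d_mesh i : (i < n)%N -> d i <= c^-1 * eta.
Proof. exact: (grid_cell_mesh x fR TG h0). Qed.

(** The weight that an interior point of the window receives in the trapezoidal sum, before any
    halving at the ends. *)
Definition design_weight i : R := n%:R^-1 * (phi K x h (T i) / f (T i)).

Let design_weightE i : design_weight i = eta * K (u i) / f (T i).
Proof.
rewrite /design_weight /phi /eta invfM -(sk_even sK ((x - T i) / h)).
by rewrite -mulNr opprB !mulrA.
Qed.

Let f_lo i : (i <= n)%N -> c <= f (T i).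
Proof. by move=> i_n; apply: (rd_lo fR); exact: (rg_in TG). Qed.

(** The weight is K(u i) eta / f (T i), and by [grid_cell_step] the quotient eta / f (T i) differs
    from d by O(h eta d). *)
Lemma design_weight_error :
  \sum_(i < n) `|design_weight i - K (u i) * d i| <= 6 * (B * C / c ^+ 2 * (h * eta)).
Proof.
apply: (@sum_touching _ f c C n T x h fR TG h0 eta_small
  (fun i => design_weight i - K (u i) * d i)) => //.
- apply: mulr_ge0; last by rewrite mulr_ge0// ltW.
  by apply: divr_ge0; [rewrite mulr_ge0|apply: exprn_ge0; exact: ltW].
- move=> i i_n _; have di := d_gt0 i_n.
  have fi := f_lo (ltnW i_n); have fi0 : 0 < f (T i) by rewrite (lt_le_trans c0).
  rewrite -/(u i) -/(u i.+1) -/(d i).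
  have -> : design_weight i - K (u i) * d i =
      - (K (u i) * (f (T i))^-1 * (f (T i) * d i - eta)).
    by rewrite design_weightE; field; rewrite gt_eqF.
  rewrite normrN normrM normrM (gtr0_norm (_ : 0 < (f (T i))^-1)) ?invr_gt0//.
  rewrite (@le_trans _ _ (B * c^-1 * (C * h * (c^-1 * eta * d i))))//; last first.
    by rewrite (_ : B * c^-1 * _ = B * C / c ^+ 2 * (h * eta) * d i)//; field; rewrite gt_eqF.
  rewrite ler_pM//.
  - by rewrite mulr_ge0// invr_ge0 ltW.
  - by rewrite ler_pM ?invr_ge0 ?(ltW fi0) ?(sk_bnd sK)// lef_pV2.
  - rewrite (le_trans (grid_cell_step x TG n0 h0 i_n))// ler_wpM2l ?mulr_ge0 ?(ltW h0)//.
    by rewrite expr2 ler_wpM2r ?(ltW di)//; exact: d_mesh.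
- move=> i i_n /negP ti.
  suff Ki : K (u i) = 0 by rewrite design_weightE -/(u i) Ki mulr0 !mul0r subr0.
  apply: (sk_out sK); apply/negP => /andP[ui1 ui2]; apply: ti.
  by rewrite /touching ui2 (lt_trans ui1)// -subr_gt0; exact: d_gt0.
Qed.

(** A design point at rescaled distance e <= eta / c from an end of the support has K of order
    eta^2, and the weight carries a further factor eta. *)
Let end_weight i (e : R) : (i <= n)%N -> 0 <= e -> e <= c^-1 * eta ->
  `|K (u i)| <= B * e ^+ 2 -> `|design_weight i| <= B / c ^+ 3 * eta ^+ 3.
Proof.
move=> i_n e0 em Ke.
have fi := f_lo i_n; have fi0 : 0 < f (T i) by rewrite (lt_le_trans c0).
rewrite design_weightE !normrM (gtr0_norm eta0) (gtr0_norm (_ : 0 < (f (T i))^-1)) ?invr_gt0//.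
rewrite (@le_trans _ _ (eta * (B * (c^-1 * eta) ^+ 2) * c^-1))//; last first.
  by rewrite (_ : eta * _ * _ = B / c ^+ 3 * eta ^+ 3)//; field; rewrite gt_eqF.
apply: ler_pM.
- by apply: mulr_ge0; [exact: ltW|exact: normr_ge0].
- by rewrite invr_ge0 ltW.
- rewrite ler_wpM2l ?(ltW eta0)// (le_trans Ke)// ler_wpM2l//.
  have ce0 : 0 <= c^-1 * eta by apply: mulr_ge0; [rewrite invr_ge0|]; exact: ltW.
  by rewrite lerXn2r ?nnegrE.
- by rewrite lef_pV2.
Qed.

Lemma first_weight i : (i < n)%N -> u i < -1 -> -1 <= u i.+1 ->
  `|design_weight i.+1| <= B / c ^+ 3 * eta ^+ 3.
Proof.
move=> i_n ui ui1.
apply: (@end_weight i.+1 (u i.+1 + 1)) => //.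
- by rewrite -lerBlDr sub0r.
- by apply: le_trans (d_mesh i_n); rewrite /d; lra.
- exact: (sk_left sK).
Qed.

Lemma last_weight i : (i < n)%N -> u i <= 1 -> 1 < u i.+1 ->
  `|design_weight i| <= B / c ^+ 3 * eta ^+ 3.
Proof.
move=> i_n ui ui1.
apply: (@end_weight i (1 - u i)) => //.
- exact: ltnW.
- by rewrite subr_ge0.
- by apply: le_trans (d_mesh i_n); rewrite /d; lra.
- exact: (sk_right sK).
Qed.

(** [a] stands for the trapezoidal weights. The bound required of them is the one that halving the
    two end weights satisfies. *)
Variable a : nat -> R.
Hypothesis a_out : forall i, (i < n)%N -> ~~ (-1 < u i < 1) -> a i = 0.
Hypothesis a_weight :
  \sum_(i < n) `|a i - design_weight i| <= B / c ^+ 3 * eta ^+ 3.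

Let D i := K (u i) * d i.

Let h1 : h <= 1.
Proof. by case/andP: x01 => x0 _; rewrite (le_trans hx1)// gerBl ltW. Qed.

Let D_out i : ~~ (-1 < u i < 1) -> D i = 0.
Proof. by move=> ui; rewrite /D (sk_out sK ui) mul0r. Qed.

Let aD : \sum_(i < n) `|a i - D i| <=
  B / c ^+ 3 * eta ^+ 3 + 6 * (B * C / c ^+ 2 * (h * eta)).
Proof.
rewrite (le_trans _ (lerD a_weight design_weight_error))// -big_split/=.
by apply: ler_sum => i _; exact: ler_distD.
Qed.

Let P1 := B / c + 6 * (B * C / c ^+ 2).

Let BC0 : 0 <= B * C / c ^+ 2.
Proof. by apply: divr_ge0; [rewrite mulr_ge0|apply: exprn_ge0; exact: ltW]. Qed.

Let P10 : 0 <= P1.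
Proof. by apply: addr_ge0; [apply: divr_ge0 => //; exact: ltW|exact: mulr_ge0]. Qed.

(** A coarser form of [aD], obtained from eta <= c and h <= 1. It is enough for the moments that the
    covariance expansion multiplies by h. *)
Let aD' : \sum_(i < n) `|a i - D i| <= P1 * eta.
Proof.
rewrite (le_trans aD)// /P1 [leRHS]mulrDl lerD//.
  rewrite (_ : B / c ^+ 3 * eta ^+ 3 = B / c * eta * (eta / c) ^+ 2); last first.
    by field; rewrite gt_eqF.
  have ec : 0 <= eta / c by rewrite divr_ge0// ltW.
  have Bc : 0 <= B / c by rewrite divr_ge0// ltW.
  apply: ler_piMr; first by apply: mulr_ge0 => //; exact: ltW.
  by rewrite exprn_ile1// ler_pdivrMr// mul1r.
rewrite -[leRHS]mulrA ler_wpM2l// ler_wpM2l//; apply: ler_piMl => //; exact: ltW.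
Qed.

Let Dsum : \sum_(i < n) `|D i| <= 6 * B.
Proof. exact: (kernel_sum_norm x fR TG h0 eta_small sK). Qed.

Lemma weight_sum_norm : \sum_(i < n) `|a i| <= 6 * B + P1 * c.
Proof.
rewrite (@le_trans _ _ (\sum_(i < n) (`|D i| + `|a i - D i|)))//.
  apply: ler_sum => i _; rewrite -{1}(subrK (D i) (a i)) addrC.
  exact: ler_normD.
rewrite big_split/= lerD//.
by rewrite (le_trans aD')// ler_wpM2l.
Qed.

(** No factor h accompanies the total weight, so the sharp bound [aD] is used: 7 = 1 + 6 and 42 = 6
    + 36 add it to [kernel_sum_error]. *)
Lemma weight_sum_error : `|\sum_(i < n) a i - 1| <=
  (7 * (B / c ^+ 3) + 42 * (B * C / c ^+ 2)) * (eta ^+ 3 + h * eta).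
Proof.
have H := kernel_sum_error fR TG n0 h0 x01 hx hx1 eta_small sK.
rewrite -/eta in H.
rewrite (_ : \sum_(i < n) a i - 1 = \sum_(i < n) (a i - D i) +
  (\sum_(i < n) D i - 1)); last by rewrite sumrB; ring.
rewrite (le_trans (ler_normD _ _))//.
rewrite (le_trans (lerD (le_trans (ler_norm_sum _ _ _) aD) H))//.
have e3 : 0 <= eta ^+ 3 by rewrite exprn_ge0// ltW.
have he : 0 <= h * eta by rewrite mulr_ge0// ltW.
have Bc : 0 <= B / c ^+ 3 by apply: divr_ge0 => //; apply: exprn_ge0; exact: ltW.
rewrite (_ : 12 * (B * (3 * C / c ^+ 2)) * (h * eta) =
  36 * (B * C / c ^+ 2 * (h * eta))); last by field; rewrite gt_eqF.
have := mulr_ge0 Bc he; have := mulr_ge0 BC0 e3.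
set X := B / c ^+ 3; set Y := B * C / c ^+ 2; move=> H1 H2.
have -> : (7 * X + 42 * Y) * (eta ^+ 3 + h * eta) = 7 * (X * eta ^+ 3) +
  7 * (X * (h * eta)) + 42 * (Y * eta ^+ 3) + 42 * (Y * (h * eta)) by ring.
rewrite -(mulrA 6 X); lra.
Qed.

Let u_bnd i : -1 < u i < 1 -> `|u i| <= 1.
Proof. by rewrite ler_norml => /andP[/ltW -> /ltW ->]. Qed.

Lemma weight_first_moment : `|\sum_(i < n) a i * u i| <= (P1 + 12 * (B / c)) * eta.
Proof.
have KM := kernel_mul_lipschitz sK (psi := id) (L := 1) (N := 1).
have := @riemann_sum_error _ f c C n T x h fR TG n0 h0 hx hx1 eta_small
  (fun v => K v * v) (B * 1 + B * 1) _ _ _.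
rewrite -/eta (kernel_first_moment sK) subr0 => H.
have {}H : `|\sum_(i < n) K (u i) * u i * d i| <= 6 * ((B * 1 + B * 1) / c) * eta.
  apply: H => [|v vI|v v'].
  - by rewrite addr_ge0// mulr_ge0.
  - by rewrite (sk_out sK vI) mul0r.
  - apply: KM => [? ?|? ?]; first by rewrite mul1r.
    by rewrite ler_norml.
rewrite (_ : \sum_(i < n) a i * u i = \sum_(i < n) (a i - D i) * u i +
    \sum_(i < n) K (u i) * u i * d i); last first.
  by rewrite -big_split/=; apply: eq_bigr => i _; rewrite /D; ring.
rewrite (le_trans (ler_normD _ _))// mulrDl lerD//; last first.
  by rewrite (le_trans H)// (_ : 6 * _ = 12 * (B / c))//; field; rewrite gt_eqF.
rewrite (le_trans (ler_norm_sum _ _ _))// (le_trans _ aD')//.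
apply: ler_sum => i _; rewrite normrM.
have [/u_bnd ui|ui] := boolP (-1 < u i < 1); first by rewrite ler_piMr.
by rewrite a_out// D_out// subrr normr0 mul0r.
Qed.

Let J := kernel_potential K.

(** [B * PJ] is the Lipschitz constant of K J: J is 2B-Lipschitz and bounded by |J 0| + 2B on
    [-1, 1]. *)
Let PJ := 2 * B + (`|J 0| + 2 * B).

Let KJ_error : `|\sum_(i < n) D i * J (u i) - kernel_C K| <= 6 * (B * PJ / c) * eta.
Proof.
have JL := kernel_potential_lipschitz sK.
have KM := kernel_mul_lipschitz sK JL.
have JN v : -1 <= v <= 1 -> `|J v| <= `|J 0| + 2 * B.
  move=> vI; rewrite -{1}(subrK (J 0) (J v)) addrC (le_trans (ler_normD _ _))// lerD//.
  rewrite (le_trans (JL _ _))// subr0 ler_piMr ?mulr_ge0//.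
  by rewrite ler_norml.
have PJ0 : 0 <= PJ by rewrite !addr_ge0// mulr_ge0.
rewrite (kernel_C_potential sK).
have := @riemann_sum_error _ f c C n T x h fR TG n0 h0 hx hx1 eta_small
  (fun v => K v * J v) (B * PJ) _ _ _.
rewrite -/eta => H.
rewrite (_ : \sum_(i < n) D i * J (u i) = \sum_(i < n) K (u i) * J (u i) * d i); last first.
  by apply: eq_bigr => i _; rewrite /D; ring.
apply: H => [|v vI|v v'].
- by rewrite mulr_ge0.
- by rewrite (sk_out sK vI) mul0r.
- by rewrite /PJ mulrDr; exact: KM.
Qed.

Let inner_error i : -1 < u i < 1 ->
  `|\sum_(j < n) D j * `|u i - u j| - J (u i)| <= 6 * (3 * B / c) * eta.
Proof.
move=> ui.
have KM := kernel_mul_lipschitz sK (psi := fun v => `|u i - v|) (L := 1) (N := 2).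
have := @riemann_sum_error _ f c C n T x h fR TG n0 h0 hx hx1 eta_small
  (fun v => K v * `|u i - v|) (3 * B) _ _ _.
rewrite -/eta => H.
rewrite (_ : \sum_(j < n) D j * `|u i - u j| =
  \sum_(j < n) K (u j) * `|u i - u j| * d j); last first.
  by apply: eq_bigr => j _; rewrite /D; ring.
rewrite (_ : J (u i) = \int[lebesgue_measure]_(v in `[-1, 1]) (K v * `|u i - v|)); last first.
  by apply: eq_Rintegral => v _; rewrite mulrC.
apply: H => [|v vI|v v'].
- by rewrite mulr_ge0.
- by rewrite (sk_out sK vI) mul0r.
- rewrite (_ : 3 * B = B * 1 + B * 2); last by ring.
  apply: KM => [w w'|w /andP[w1 w2]].
    rewrite mul1r (le_trans (ler_dist_dist _ _))// (distrC w).
    by rewrite (_ : u i - w - (u i - w') = w' - w)//; ring.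
  rewrite ger0_norm ?normr_ge0//; move: (u i) ui => z /andP[? ?].
  by rewrite ler_norml; apply/andP; split; lra.
Qed.

(** The three summands bound, in order, the replacement of [a] by [D] (2 bounds the distance of two
    points of the support), of the inner sum by the potential J, and of the outer sum by
    [kernel_C K]. *)
Definition potential_constant : R :=
  2 * (P1 * (6 * B + P1 * c + 6 * B)) + 6 * B * (6 * (3 * B / c)) + 6 * (B * PJ / c).

Lemma weight_potential_error :
  `|\sum_(i < n) \sum_(j < n) a i * a j * `|u i - u j| - kernel_C K|
    <= potential_constant * eta.
Proof.
have -> : \sum_(i < n) \sum_(j < n) a i * a j * `|u i - u j| - kernel_C K =
    \sum_(i < n) \sum_(j < n) (a i * a j - D i * D j) * `|u i - u j|
  + \sum_(i < n) D i * (\sum_(j < n) D j * `|u i - u j| - J (u i))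
  + (\sum_(i < n) D i * J (u i) - kernel_C K).
  rewrite [RHS]addrA -2!big_split/=; congr (_ - _); apply: eq_bigr => i _.
  rewrite mulrBr -addrA subrK mulr_sumr -big_split/=; apply: eq_bigr => j _; ring.
rewrite (le_trans (ler_normD _ _))// /potential_constant mulrDl lerD ?KJ_error//.
rewrite (le_trans (ler_normD _ _))// mulrDl lerD//; last first.
  rewrite (le_trans (ler_norm_sum _ _ _))//.
  rewrite (@le_trans _ _ (\sum_(i < n) `|D i| * (6 * (3 * B / c) * eta)))//.
    apply: ler_sum => i _; rewrite normrM.
    have [/inner_error ui|ui] := boolP (-1 < u i < 1); first by rewrite ler_wpM2l.
    by rewrite D_out// normr0 !mul0r.
  rewrite -mulr_suml -(mulrA (6 * B)) ler_wpM2r// mulr_ge0 ?(ltW eta0)//.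
  by rewrite mulr_ge0// divr_ge0 ?(ltW c0)// mulr_ge0.
have aS := weight_sum_norm.
rewrite (le_trans (ler_norm_sum _ _ _))//.
rewrite (@le_trans _ _ (\sum_(i < n) \sum_(j < n)
    2 * (`|a i - D i| * `|a j| + `|D i| * `|a j - D j|)))//.
  apply: ler_sum => i _; rewrite (le_trans (ler_norm_sum _ _ _))//.
  apply: ler_sum => j _.
  have E : `|a i * a j - D i * D j| <= `|a i - D i| * `|a j| + `|D i| * `|a j - D j|.
    rewrite (_ : a i * a j - D i * D j = (a i - D i) * a j + D i * (a j - D j)); last by ring.
    by rewrite (le_trans (ler_normD _ _))// !normrM.
  rewrite normrM normr_id mulrC.
  have [ui|ui] := boolP (-1 < u i < 1); last first.
    by rewrite (a_out _ ui)// D_out// !mul0r subrr normr0 mulr0 mul0r mul0r addr0 mulr0.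
  have [uj|uj] := boolP (-1 < u j < 1); last first.
    by rewrite (a_out _ uj)// (D_out uj) !mulr0 subrr normr0 !mulr0 addr0 mulr0.
  apply: ler_pM => //.
  move: (u i) (u j) ui uj => y z /andP[? ?] /andP[? ?].
  by rewrite ler_norml; apply/andP; split; lra.
under eq_bigr => i _ do rewrite -mulr_sumr big_split/= -!mulr_sumr.
rewrite -mulr_sumr big_split/= -!mulr_suml -(mulrA 2) ler_wpM2l//.
rewrite [leRHS](_ : _ = P1 * eta * (6 * B + P1 * c) + 6 * B * (P1 * eta)); last by ring.
by rewrite lerD// ler_pM// sumr_ge0.
Qed.

(** With A1, A2, A3 the total weight, first moment and double sum, the expansion of g gives G0 A1^2
    + 2 beta h A1 A2 - alpha/2 h A3 plus a remainder; A1^2 - 1 is factored as (A1 - 1)(A1 + 1). *)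
Lemma weighted_covariance_error (G0 beta alpha e : R) (g : nat -> nat -> R) :
  0 <= e ->
  (forall i j, (i < n)%N -> (j < n)%N -> -1 < u i < 1 -> -1 < u j < 1 ->
    `|g i j - (G0 + beta * h * (u i + u j) - alpha / 2 * h * `|u i - u j|)| <= e * h) ->
  `|\sum_(i < n) \sum_(j < n) a i * a j * g i j - (G0 - h / 2 * kernel_C K * alpha)|
  <= `|G0| * ((7 * (B / c ^+ 3) + 42 * (B * C / c ^+ 2)) * (eta ^+ 3 + h * eta)
              * (6 * B + P1 * c + 1))
   + 2 * `|beta| * h * (6 * B + P1 * c) * ((P1 + 12 * (B / c)) * eta)
   + `|alpha| / 2 * h * (potential_constant * eta)
   + (6 * B + P1 * c) ^+ 2 * (e * h).
Proof.
move=> e0 Hg.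
have aS := weight_sum_norm; have a1 := weight_sum_error.
have a2 := weight_first_moment; have a3 := weight_potential_error.
set A1 := \sum_(i < n) a i in a1.
set A2 := \sum_(i < n) a i * u i in a2.
set A3 := \sum_(i < n) \sum_(j < n) a i * a j * `|u i - u j| in a3.
set S := \sum_(i < n) `|a i| in aS.
have A1S : `|A1| <= S by exact: ler_norm_sum.
set r := fun i j => g i j - (G0 + beta * h * (u i + u j) - alpha / 2 * h * `|u i - u j|).
have -> : \sum_(i < n) \sum_(j < n) a i * a j * g i j - (G0 - h / 2 * kernel_C K * alpha) =
    G0 * ((A1 - 1) * (A1 + 1)) + 2 * beta * h * A1 * A2
  - alpha / 2 * h * (A3 - kernel_C K) + \sum_(i < n) \sum_(j < n) a i * a j * r i j.
  have -> : \sum_(i < n) \sum_(j < n) a i * a j * g i j =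
      G0 * (A1 * A1) + beta * h * (A2 * A1) + beta * h * (A1 * A2)
      - alpha / 2 * h * A3 + \sum_(i < n) \sum_(j < n) a i * a j * r i j.
    rewrite {1 2 3 4}/A1 {1 2}/A2 !big_distrlr /A3 !mulr_sumr -!big_split/= -sumrB -big_split/=.
    apply: eq_bigr => i _; rewrite !mulr_sumr -!big_split/= -sumrB -big_split/=.
    by apply: eq_bigr => j _; rewrite /r; ring.
  by ring.
have S0 : 0 <= S by apply: sumr_ge0.
have SA := le_trans S0 aS.
rewrite (le_trans (ler_normD _ _))// lerD//; last first.
  rewrite (le_trans (ler_norm_sum _ _ _))//.
  rewrite (@le_trans _ _ (\sum_(i < n) \sum_(j < n) `|a i| * `|a j| * (e * h)))//.
    apply: ler_sum => i _; rewrite (le_trans (ler_norm_sum _ _ _))//.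
    apply: ler_sum => j _; rewrite !normrM.
    have [ui|ui] := boolP (-1 < u i < 1); last by rewrite (a_out _ ui)// normr0 !mul0r.
    have [uj|uj] := boolP (-1 < u j < 1); last by rewrite (a_out _ uj)// normr0 !mulr0 !mul0r.
    by rewrite ler_wpM2l ?mulr_ge0//; exact: Hg.
  under eq_bigr => i _ do rewrite -mulr_suml.
  rewrite -mulr_suml -big_distrlr/= -expr2 ler_wpM2r ?mulr_ge0 ?(ltW h0)//.
  by rewrite lerXn2r.
rewrite (le_trans (ler_normB _ _))// lerD//; last first.
  have ah : 0 <= `|alpha| / 2 * h by rewrite mulr_ge0 ?divr_ge0// ltW.
  rewrite normrM (_ : `|alpha / 2 * h| = `|alpha| / 2 * h) ?ler_wpM2l//.
  by rewrite !normrM (gtr0_norm h0) (@ger0_norm _ 2^-1).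
rewrite (le_trans (ler_normD _ _))// lerD//.
  rewrite normrM ler_wpM2l// normrM ler_pM// (le_trans (ler_normD _ _))// normr1.
  by rewrite lerD2r (le_trans A1S).
rewrite 4!normrM (gtr0_norm h0) (@ger0_norm _ 2)//.
rewrite ler_pM ?mulr_ge0 ?(ltW h0)// ler_wpM2l ?mulr_ge0 ?(ltW h0)//.
exact: le_trans A1S aS.
Qed.

End WeightedSums.

(** * The trapezoidal weights *)

Section TrapezoidalWeights.
Context {R : realType}.
Implicit Types (b : nat -> R) (s : seq nat).

Lemma sum_consecutive b i s :
  \sum_(k < size s) (b (nth 0%N (i :: s) k) + b (nth 0%N (i :: s) k.+1)) =
  2 * (\sum_(j <- i :: s) b j) - b i - b (last i s).
Proof.
elim: s i => [|j s IH] i; first by rewrite big_ord0 big_seq1 /=; ring.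
rewrite big_ord_recl /= (IH j) !big_cons; ring.
Qed.

(** This is 1/2 at each end of a list of at least two distinct indices, and 0 for a single index, in
    agreement with the empty trapezoidal sum. *)
Definition edge_factor s i : R := 1 - (i == head 0%N s)%:R / 2 - (i == last 0%N s)%:R / 2.

Lemma sum_trapezoid b s : uniq s ->
  \sum_(k < (size s).-1) (b (nth 0%N s k) + b (nth 0%N s k.+1)) =
  2 * \sum_(j <- s) edge_factor s j * b j.
Proof.
case: s => [|i s us]; first by rewrite big_ord0 big_nil mulr0.
have pick p : p \in i :: s -> \sum_(j <- i :: s) (j == p)%:R * b j = b p.
  move=> ps; rewrite (bigD1_seq p)//= eqxx mul1r big1 ?addr0// => j /negPf ->.
  by rewrite mul0r.
rewrite [(size _).-1]/= sum_consecutive /edge_factor [head _ _]/= [last 0%N _]/=.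
rewrite -{1}(pick i) ?mem_head// -{1}(pick (last i s)) ?mem_last//.
by rewrite !mulr_sumr -!sumrB; apply: eq_bigr => j _; field.
Qed.

Lemma sum_pick_le (n : nat) (v : nat -> R) (V : R) (p : nat) : 0 <= V ->
  ((p < n)%N -> `|v p| <= V) -> \sum_(i < n) `|v i| * (i == p :> nat)%:R <= V.
Proof.
move=> V0 vV; have [pn|np] := ltnP p n; last first.
  rewrite big1// => i _; rewrite (_ : (i == p :> nat) = false) ?mulr0//.
  by apply/negP => /eqP ip; move: np; rewrite -ip leqNgt ltn_ord.
rewrite (bigD1 (Ordinal pn))//= eqxx mulr1 big1 ?addr0 ?vV// => i /negPf ip.
by rewrite (_ : (i == p :> nat) = false) ?mulr0.
Qed.

Lemma ltn_sorted_last i s j : path ltn i s -> j \in i :: s -> (j <= last i s)%N.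
Proof.
elim: s i j => [|k s IH] i j /=; first by rewrite inE => _ /eqP ->.
move=> /andP[ik ks]; rewrite inE => /predU1P[->|]; last exact: IH.
by rewrite (leq_trans (ltnW ik))// IH// mem_head.
Qed.

End TrapezoidalWeights.

Section TrapezoidalEstimator.
Context {R : realType}.
Variables (K f : R -> R) (n : nat) (x h : R).
Let T := design_point f n.

Definition window : seq nat := [seq i <- iota 1 n | x - h <= T i <= x + h].

Definition trap_weight i : R := edge_factor window i * design_weight f K n T x h i.

(** Outside the window K vanishes, so the sum may run over all design indices. For n = 0 both sides
    are empty sums, and positivity of h is asked for n > 0 only, as for the bandwidth. *)
Lemma ghat_trap_weights (Y : R -> R) :
  (forall u, ~~ (-1 <= u <= 1) -> K u = 0) -> ((0 < n)%N -> 0 < h) ->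
  ghat_trap K f n h Y x = \sum_(i <- iota 1 n) trap_weight i * Y (T i).
Proof.
move=> K0 h0; pose b i := phi K x h (T i) / f (T i) * Y (T i).
have -> : \sum_(i <- iota 1 n) trap_weight i * Y (T i) =
    n%:R^-1 * \sum_(i <- window) edge_factor window i * b i.
  rewrite mulr_sumr big_filter [RHS]big_mkcond/= big_seq [RHS]big_seq.
  apply: eq_bigr => i; rewrite mem_iota add1n ltnS => /andP[i1 i_n].
  case: ifPn => [_|out]; first by rewrite /trap_weight /design_weight /b; ring.
  have {}h0 := h0 (leq_trans i1 i_n).
  rewrite /trap_weight /design_weight /phi K0 ?mulr0 ?mul0r ?mulr0 ?mul0r//.
  apply: contra out; rewrite ler_pdivrMr// ler_pdivlMr// mulN1r mul1r.
  by move=> /andP[? ?]; apply/andP; split; lra.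
rewrite /ghat_trap.
have -> : local_design f n x h = map T window by rewrite /local_design filter_map.
rewrite size_map.
have uw : uniq window by rewrite filter_uniq// iota_uniq.
rewrite (eq_bigr (fun k : 'I_(size window).-1 =>
  b (nth 0%N window k) + b (nth 0%N window k.+1))); last first.
  move=> k _; have k1 : (k.+1 < size window)%N.
    by rewrite -ltn_predRL; exact: ltn_ord.
  by rewrite !(nth_map 0%N)// ltnW.
rewrite sum_trapezoid// invfM mulrA; congr (_ * _).
by rewrite mulrAC mulVf ?mul1r// pnatr_eq0.
Qed.

Variables (K1 F : R -> R) (c C B : R).
Hypothesis sK : smooth_kernel K K1 F B.
Hypothesis fR : regular_density f c C.
Hypothesis TG : regular_grid f c C n T.
Hypotheses (n0 : (0 < n)%N) (h0 : 0 < h) (hx : h < x) (hx1 : h < 1 - x).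

Let eta := (n%:R * h)^-1.
Let u i := (T i - x) / h.

Lemma design_weight_out i : ~~ (-1 < u i < 1) -> design_weight f K n T x h i = 0.
Proof.
move=> ui; rewrite /design_weight /phi.
have -> : (x - T i) / h = - u i by rewrite /u -mulNr opprB.
by rewrite (sk_even sK) (sk_out sK ui) mulr0 mul0r mulr0.
Qed.

Lemma trap_weight_out i : ~~ (-1 < u i < 1) -> trap_weight i = 0.
Proof. by move=> ui; rewrite /trap_weight design_weight_out// mulr0. Qed.

Let u0_out : ~~ (-1 < u 0%N < 1).
Proof.
rewrite negb_and -leNgt /u (rg_first TG) sub0r mulNr lerN2 ler_pdivlMr// mul1r.
by rewrite (ltW hx).
Qed.

Let un_out : ~~ (-1 < u n < 1).
Proof.
rewrite negb_and -!leNgt /u (rg_last TG) ler_pdivlMr// mul1r.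
by rewrite (ltW hx1) orbT.
Qed.

(** The ranges 1..n and 0..n-1 differ by the points 0 and 1, which lie outside the support because h
    < x and h < 1 - x. *)
Lemma sum_iota_trap_weight (g : nat -> R) :
  \sum_(i <- iota 1 n) trap_weight i * g i = \sum_(i < n) trap_weight i * g i.
Proof.
have -> : iota 1 n = index_iota 1 n.+1 by rewrite /index_iota subn1.
rewrite -(big_mkord xpredT (fun i => trap_weight i * g i)).
rewrite big_nat_recr//= (trap_weight_out un_out) mul0r addr0.
by rewrite [RHS]big_ltn// (trap_weight_out u0_out) mul0r add0r.
Qed.

Let V := B / c ^+ 3 * eta ^+ 3.

Let V0 : 0 <= V.
Proof.
apply: mulr_ge0.
  by apply: divr_ge0; [case: sK|apply: exprn_ge0; apply: ltW; case: fR].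
by apply: exprn_ge0; rewrite invr_ge0 mulr_ge0// ltW.
Qed.

Let window_sorted : sorted ltn window.
Proof. by apply: sorted_filter; [exact: ltn_trans|exact: iota_ltn_sorted]. Qed.

Let mem_window i : (i \in window) = [&& (0 < i)%N, (i <= n)%N & x - h <= T i <= x + h].
Proof. by rewrite mem_filter mem_iota add1n ltnS andbC -andbA. Qed.

(** The cell ending at the first window point must start before x - h, otherwise its left end would
    be an earlier point of the window; [first_weight] then applies. *)
Let first_weight_le : `|design_weight f K n T x h (head 0%N window)| <= V.
Proof.
(* For an empty window [head] returns the default 0, whose design point 0 has weight 0. *)
case E : window => [|i s] /=; first by rewrite design_weight_out ?normr0.
have : i \in window by rewrite E mem_head.
rewrite mem_window => /and3P[i1 i_n /andP[lo hi]].
case: i i1 E i_n lo hi => // i _ E i_n lo hi.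
have Ti : T i < x - h.
  case: i E i_n lo hi => [|i] E i_n lo hi; first by rewrite (rg_first TG) subr_gt0.
  rewrite ltNge; apply/negP => lo'.
  have : i.+1 \in window.
    rewrite mem_window (ltnW i_n) lo' /= (le_trans _ hi)//.
    exact: ltW (rg_lt TG i_n).
  have := window_sorted; rewrite E /= => ps; rewrite inE => /predU1P[/eqP|].
    by rewrite eqn_leq ltnn andbF.
  move: ps => /(order_path_min ltn_trans) /allP H /H.
  by rewrite /= ltnNge leqnSn.
apply: (first_weight sK fR TG n0 h0) => //.
- by rewrite ltr_pdivrMr// mulN1r; lra.
- by rewrite ler_pdivlMr// mulN1r; lra.
Qed.

Let last_weight_le : `|design_weight f K n T x h (last 0%N window)| <= V.
Proof.
case E : window => [|i s] /=; first by rewrite design_weight_out ?normr0.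
move: (last i s) (mem_last i s) (@ltn_sorted_last i s) => l.
rewrite -E => lw lmax.
move: (lw); rewrite mem_window => /and3P[l1 l_n /andP[lo hi]].
have {}l_n : (l < n)%N.
  rewrite ltn_neqAle l_n andbT; apply/eqP => ln.
  by move: hi; rewrite ln (rg_last TG) leNgt -ltrBrDl hx1.
have Tl : x + h < T l.+1.
  rewrite ltNge; apply/negP => hi'.
  have lw1 : l.+1 \in window.
    rewrite mem_window l_n hi' /= andbT (le_trans lo)//.
    exact: ltW (rg_lt TG l_n).
  have ps := window_sorted; rewrite E /= in ps.
  by have := lmax _ ps lw1; rewrite ltnn.
apply: (last_weight sK fR TG n0 h0) => //.
- by rewrite ler_pdivrMr// mul1r; lra.
- by rewrite ltr_pdivlMr// mul1r; lra.
Qed.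

(** Only the two end weights change, each by half of its size, so the total change is at most (V +
    V) / 2. *)
Lemma trap_weight_error :
  \sum_(i < n) `|trap_weight i - design_weight f K n T x h i| <= V.
Proof.
set v := design_weight f K n T x h.
rewrite (@le_trans _ _ (\sum_(i < n) (`|v i| * (i == head 0%N window :> nat)%:R
   + `|v i| * (i == last 0%N window :> nat)%:R) / 2))//.
  apply: ler_sum => i _; rewrite /trap_weight /edge_factor -/v.
  set p := (i == head 0%N window :> nat)%:R; set q := (i == last 0%N window :> nat)%:R.
  have pq0 : 0 <= (p + q) / 2 :> R by rewrite divr_ge0// addr_ge0.
  rewrite (_ : _ - v i = - (v i * ((p + q) / 2))); last by field.
  by rewrite normrN normrM (ger0_norm pq0) mulrA mulrDr.
rewrite -mulr_suml big_split/= ler_pdivrMr// mulr_natr mulr2n lerD//.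
- by apply: sum_pick_le => // _; exact: first_weight_le.
- by apply: sum_pick_le => // _; exact: last_weight_le.
Qed.

End TrapezoidalEstimator.

(** * Variance expansion *)

Lemma autocovarianceC {R : realType} d (Omega : measurableType d)
    (P : probability Omega R) (X : R -> {RV P >-> R}) (s t : R) :
  autocovariance X s t = autocovariance X t s.
Proof.
by rewrite /autocovariance; congr (fine 'E_P[_]); apply/funext => w /=; rewrite mulrC.
Qed.

Section Asymptotics.
Context {R : realType}.
Variables (K f : R -> R) (x : R) (G : R -> R -> R) (b : nat -> R).
Hypotheses (Kk : kernel_function K) (KD : assumptionD K).
Hypotheses (fD : density01 f) (fC2 : C2_on unit_itv f) (x01 : 0 < x < 1).
Hypotheses (GA : assumptionA G) (GB : assumptionB G) (GC : assumptionC G).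
Hypothesis G_sym : forall s t, G s t = G t s.
Hypothesis b_gt0 : forall n, (0 < n)%N -> 0 < b n.
Hypothesis b_cvg0 : b n @[n --> \oo] --> 0.
Hypothesis nb_cvgy : n%:R * b n @[n --> \oo] --> +oo.

Definition covariance_sum (n : nat) : R :=
  \sum_(i <- iota 1 n) \sum_(j <- iota 1 n)
    trap_weight K f n x (b n) i * trap_weight K f n x (b n) j
    * G (design_point f n i) (design_point f n j).

Let eta n := (n%:R * b n)^-1.

Let near_eta (e : R) : 0 < e -> \forall n \near \oo, eta n <= e.
Proof.
move=> e0; move/cvgryPge : nb_cvgy => /(_ e^-1) H; near=> n.
have Hn : e^-1 <= n%:R * b n by near: n.
have nb0 : 0 < n%:R * b n by rewrite (lt_le_trans _ Hn)// invr_gt0.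
by rewrite /eta -[e]invrK lef_pV2 ?posrE ?invr_gt0.
Unshelve. all: by end_near. Qed.

Let near_b (e : R) : 0 < e -> \forall n \near \oo, b n < e.
Proof.
move=> e0; near=> n.
have Hn : `|b n| < e by near: n; exact: (cvgr0_norm_lt _ b_cvg0 _ e0).
by rewrite (le_lt_trans _ Hn)// ler_norm.
Unshelve. all: by end_near. Qed.

(* The term in V is o(h), since 1/(n^2 h) = h (nh)^-2. *)
Lemma covariance_sum_expansion : exists2 Q : R, 0 <= Q & forall e : R, 0 < e ->
  \forall n \near \oo,
    `|covariance_sum n - (G x x - b n / 2 * kernel_C K * jump G x)
      - kernel_V K / (12 * n%:R ^+ 2 * b n) * (jump G x / f x ^+ 2)|
    <= Q * eta n ^+ 3 + e * b n.
Proof.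
have [K1 [F [B sK]]] := smooth_kernel_exists KD Kk.
have [c [C fR]] := regular_density_exists fD fC2.
have c0 : 0 < c by case: fR.
have C0 : 0 <= C by case: fR.
have B0 : 0 <= B by case: sK.
set SA := 6 * B + (B / c + 6 * (B * C / c ^+ 2)) * c.
set X := 7 * (B / c ^+ 3) + 42 * (B * C / c ^+ 2).
set PC := potential_constant K c C B.
set P2 := B / c + 6 * (B * C / c ^+ 2) + 12 * (B / c).
set beta := (diag_left G x + diag_right G x) / 2.
set alpha := jump G x.
have Bc : 0 <= B / c by rewrite divr_ge0// ltW.
have Bc3 : 0 <= B / c ^+ 3 by apply: divr_ge0 => //; apply: exprn_ge0; exact: ltW.
have BC : 0 <= B * C / c ^+ 2.
  by apply: divr_ge0; [exact: mulr_ge0|apply: exprn_ge0; exact: ltW].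
have SA0 : 0 <= SA.
  apply: addr_ge0; first by rewrite mulr_ge0.
  by apply: mulr_ge0; [apply: addr_ge0 => //; exact: mulr_ge0|exact: ltW].
have X0 : 0 <= X by apply: addr_ge0; exact: mulr_ge0.
(* Q carries the eta^3 error of the total weight and must not depend on e; every other error has a
   factor h. *)
pose Q := `|G x x| * X * (SA + 1).
have Q0 : 0 <= Q by rewrite !mulr_ge0// addr_ge0.
exists Q => // e e0.
(* The errors with a factor h share e in thirds: Q' collects the coefficients of h eta, W is the
   coefficient of h eta^2 in the term in V, and e' below absorbs the factor SA^2 of the covariance
   remainder. *)
pose Q' := Q + 2 * `|beta| * SA * P2 + `|alpha| / 2 * PC.
pose W := `|kernel_V K / 12 * (alpha / f x ^+ 2)|.
have e30 : 0 < e / 3 by rewrite divr_gt0.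
have S1 : 0 < SA ^+ 2 + 1 by rewrite ltr_wpDl// sqr_ge0.
pose e' := e / 3 / (SA ^+ 2 + 1).
have e'0 : 0 < e' by rewrite divr_gt0.
have [r r0 Hr] := covariance_diagonal_expansion G_sym GA GB GC x01 e'0.
have Q1 : 0 < `|Q'| + 1 by rewrite ltr_wpDl.
have W1 : 0 < W + 1 by rewrite ltr_wpDl// normr_ge0.
have e1 : 0 < e / 3 / (`|Q'| + 1) by rewrite divr_gt0.
have e2 : 0 < e / 3 / (W + 1) by rewrite divr_gt0.
have /andP[x0 x1] := x01; have x1' : 0 < 1 - x by rewrite subr_gt0.
near=> n.
have n0 : (0 < n)%N by near: n; exact: nbhs_infty_gt.
have h0 := b_gt0 n0.
have hx : b n < x by near: n; exact: near_b.
have hx1 : b n < 1 - x by near: n; exact: near_b.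
have hr : b n < r by near: n; exact: near_b.
have etac : eta n <= c by near: n; exact: near_eta.
have eta1 : eta n <= 1 by near: n; exact: near_eta.
have etaQ : eta n <= e / 3 / (`|Q'| + 1) by near: n; exact: near_eta.
have etaW : eta n <= e / 3 / (W + 1) by near: n; exact: near_eta.
have eta0 : 0 < eta n by rewrite invr_gt0 mulr_gt0// ltr0n.
set h := b n in h0 hx hx1 hr *.
have TG := design_point_grid fD fC2 fR n0.
pose T := design_point f n.
pose a := trap_weight K f n x h.
have -> : covariance_sum n = \sum_(i < n) \sum_(j < n) a i * a j * G (T i) (T j).
  rewrite /covariance_sum.
  transitivity (\sum_(i <- iota 1 n) a i * \sum_(j <- iota 1 n) a j * G (T i) (T j)).
    by apply: eq_bigr => i _; rewrite mulr_sumr; apply: eq_bigr => j _; rewrite mulrA.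
  rewrite (sum_iota_trap_weight sK TG n0 h0 hx hx1
    (fun i => \sum_(j <- iota 1 n) a j * G (T i) (T j))).
  apply: eq_bigr => i _.
  rewrite (sum_iota_trap_weight sK TG n0 h0 hx hx1 (fun j => G (T i) (T j))).
  by rewrite mulr_sumr; apply: eq_bigr => j _; rewrite mulrA.
have key := weighted_covariance_error sK fR TG n0 h0 x01 (ltW hx) (ltW hx1) etac
  (fun i _ ui => trap_weight_out sK ui) (trap_weight_error sK fR TG n0 h0 hx hx1)
  (G0 := G x x) (beta := beta) (alpha := alpha) (g := fun i j => G (T i) (T j)) (ltW e'0).
have {}key : `|\sum_(i < n) \sum_(j < n) a i * a j * G (T i) (T j)
    - (G x x - h / 2 * kernel_C K * alpha)|
  <= Q * eta n ^+ 3 + Q' * eta n * h + SA ^+ 2 * e' * h.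
  apply: le_trans (key _) _.
    move=> i j i_n j_n ui uj.
    have TE k : T k = x + h * ((T k - x) / h).
      by rewrite mulrC divfK ?gt_eqF// addrC subrK.
    have Th k : -1 < (T k - x) / h < 1 -> `|T k - x| <= h.
      rewrite ltr_pdivlMr// ltr_pdivrMr// mulN1r mul1r => /andP[? ?].
      by rewrite ler_norml !ltW.
    have := Hr (T i) (T j) h hr (Th _ ui) (Th _ uj).
    rewrite -/beta -/alpha; congr (`|_ - _| <= _).
    rewrite [T i - T j](_ : _ = h * ((T i - x) / h - (T j - x) / h)); last first.
      by rewrite {1}(TE i) {1}(TE j); ring.
    rewrite normrM (gtr0_norm h0) {1}(TE i) {1}(TE j); ring.
  rewrite -/X -/SA -/P2 -/PC -/(eta n).
  rewrite le_eqVlt; apply/orP; left; apply/eqP.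
  by rewrite /Q' /Q; ring.
have VE : kernel_V K / (12 * n%:R ^+ 2 * h) * (alpha / f x ^+ 2) =
    kernel_V K / 12 * (alpha / f x ^+ 2) * (h * eta n ^+ 2).
  have fx0 : f x != 0.
    have xI : 0 <= x <= 1 by rewrite (ltW x0) (ltW x1).
    by rewrite gt_eqF// (lt_le_trans c0)// (rd_lo fR).
  by rewrite /eta -/h; field; rewrite fx0 gt_eqF//= pnatr_eq0 -lt0n n0.
rewrite VE (le_trans (ler_normB _ _))// normrM -/W.
have he : `|h * eta n ^+ 2| = h * eta n ^+ 2.
  by rewrite ger0_norm// mulr_ge0 ?(ltW h0)// exprn_ge0// ltW.
rewrite he (le_trans (lerD key (lexx _)))//.
rewrite -!addrA lerD2l (_ : e * h = e / 3 * h + (e / 3 * h + e / 3 * h)); last by field.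
have W0 : 0 <= W by rewrite normr_ge0.
rewrite lerD//; [|rewrite lerD//].
- rewrite ler_wpM2r ?(ltW h0)// (@le_trans _ _ ((`|Q'| + 1) * eta n))//.
    by rewrite ler_wpM2r ?(ltW eta0)// (le_trans (ler_norm _))// lerDl.
  by rewrite mulrC -ler_pdivlMr.
- rewrite ler_wpM2r ?(ltW h0)// (@le_trans _ _ ((SA ^+ 2 + 1) * e'))//.
    by rewrite ler_wpM2r ?(ltW e'0)// lerDl.
  by rewrite /e' mulrC divfK// gt_eqF.
- rewrite mulrCA mulrC ler_wpM2r ?(ltW h0)// (@le_trans _ _ ((W + 1) * eta n))//.
    rewrite expr2 mulrA ler_wpM2r ?(ltW eta0)// (@le_trans _ _ W) ?lerDl//.
    exact: ler_piMr.
  by rewrite mulrC -ler_pdivlMr.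
Unshelve. all: by end_near. Qed.

End Asymptotics.

(** Clipping y at level a splits it into a part bounded by a and a rest bounded by every c with |y|
    <= a + c. The splitting does not depend on c, as an o term requires. *)
Lemma clip_bounds {R : realType} (y a : R) : 0 <= a ->
  `|Num.max (- a) (Num.min y a)| <= a /\
  (forall c : R, 0 <= c -> `|y| <= a + c -> `|y - Num.max (- a) (Num.min y a)| <= c).
Proof.
move=> a0; split.
  have Na : - a <= a by rewrite ge0_cp.
  by rewrite ler_norml le_max lexx /= ge_max ge_min lexx orbT andbT.
move=> c c0; rewrite !ler_norml => /andP[y1 y2].
have [ya|ya] := leP y a.
  have [ay|ay] := leP (- a) y; first by apply/andP; split; lra.
  by apply/andP; split; lra.
rewrite max_r ?ge0_cp//; apply/andP; split; lra.
Qed.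

Theorem proposition2 (R : realType)
  (* the processes eps_j, and the process eps of which they are copies *)
  (d d0 : measure_display)
  (Omega : measurableType d) (P : probability Omega R)
  (Omega0 : measurableType d0) (P0 : probability Omega0 R)
  (eps : nat -> R -> {RV P >-> R}) (eps0 : R -> {RV P0 >-> R})
  (g f K : R -> R)
  (* m n replications are observed with n design points; h n k is the bandwidth
     for n design points and k replications *)
  (h : nat -> nat -> R) (m : nat -> nat) (x : R) :
  centered_second_order eps0 ->
  iid_copies eps eps0 ->
  C2_on unit_itv g ->
  density01 f ->
  kernel_function K ->
  (forall n k, (0 < n)%N -> (0 < k)%N -> 0 < h n k < 1) ->
  (forall n, (0 < m n)%N) ->
  assumptionA (autocovariance eps0) ->
  assumptionB (autocovariance eps0) ->
  assumptionC (autocovariance eps0) ->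
  assumptionD K ->
  C2_on unit_itv f ->
  second_deriv_lipschitz unit_itv f ->
  lipschitz_mixed02 (autocovariance eps0) ->
  h n (m n) @[n --> \oo] --> 0 ->
  n%:R * h n (m n) @[n --> \oo] --> +oo ->
  0 < x < 1 ->
  exists r1 r2 : nat -> R,
    [/\ forall n : nat,
          variance P (fun w => ghat_trap K f n (h n (m n))
                          (fun t => Ymean g eps (m n) t w) x) =
          ((m n)%:R^-1 *
             (autocovariance eps0 x x -
              h n (m n) / 2 * kernel_C K * jump (autocovariance eps0) x) +
           kernel_V K / (12 * (m n)%:R * n%:R ^+ 2 * h n (m n)) *
             (jump (autocovariance eps0) x / f x ^+ 2) +
           r1 n + r2 n)%:E,
        r1 =o_\oo (fun n => h n (m n) / (m n)%:R)
      & r2 =O_\oo (fun n => ((m n)%:R * n%:R ^+ 2)^-1 +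
                            ((m n)%:R * n%:R ^+ 3 * h n (m n) ^+ 3)^-1)].
Proof.
move=> eps0_L2 eps_iid gC2 fD Kk h01 m0 GA GB GC KD fC2 _ _ b_cvg0 nb_cvgy x01.
set G := autocovariance eps0 in GA GB GC *; pose b n := h n (m n).
have b_gt0 n : (0 < n)%N -> 0 < b n by move=> n0; have /andP[] := h01 n (m n) n0 (m0 n).
have [Q Q0 HQ] := covariance_sum_expansion Kk KD fD fC2 x01 GA GB GC
  (autocovarianceC eps0) b_gt0 b_cvg0 nb_cvgy.
have varE n : variance P (fun w => ghat_trap K f n (b n)
    (fun t => Ymean g eps (m n) t w) x) = ((m n)%:R^-1 * covariance_sum K f x G b n)%:E.
  (* [variance_linear_Ymean] wants sampling points in [0, 1] for every index; those that are not
     grid indices are sent to 0. *)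
  pose tau i := if (0 < n)%N && (i <= n)%N then design_point f n i else 0.
  have tau01 i : unit_itv (tau i).
    rewrite /tau /unit_itv/= in_itv/=; case: ifPn => [/andP[n0 i_n]|_].
      have [c [C fR]] := regular_density_exists fD fC2.
      exact: rg_in (design_point_grid fD fC2 fR n0) i i_n.
    by rewrite lexx ler01.
  have tauE i : i \in iota 1 n -> tau i = design_point f n i.
    by rewrite mem_iota add1n ltnS /tau => /andP[i1 i_n]; rewrite (leq_trans i1 i_n) i_n.
  have Kout u : ~~ (-1 <= u <= 1) -> K u = 0.
    have [K1 [F [B sK]]] := smooth_kernel_exists KD Kk.
    by move=> uI; apply: (sk_out sK); apply: contra uI => /andP[/ltW -> /ltW ->].
  have -> : (fun w => ghat_trap K f n (b n) (fun t => Ymean g eps (m n) t w) x) =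
      (fun w => \sum_(i <- iota 1 n) trap_weight K f n x (b n) i
                  * Ymean g eps (m n) (tau i) w).
    apply/funext => w; rewrite ghat_trap_weights//; last exact: b_gt0.
    by rewrite big_seq [RHS]big_seq; apply: eq_bigr => i /tauE ->.
  rewrite (variance_linear_Ymean eps0_L2 eps_iid)//; congr ((_ * _)%:E).
  rewrite /covariance_sum big_seq [RHS]big_seq; apply: eq_bigr => i /tauE ->.
  by rewrite big_seq [RHS]big_seq; apply: eq_bigr => j /tauE ->.
pose V n := kernel_V K / (12 * n%:R ^+ 2 * b n) * (jump G x / f x ^+ 2).
pose err n := covariance_sum K f x G b n - (G x x - b n / 2 * kernel_C K * jump G x) - V n.
pose eta n := (n%:R * b n)^-1.
(* The clipped error is the O term and the rest the o term. The absolute value keeps the clipping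
   level nonnegative with no condition on n. *)
pose clip n := let q := Q * `|eta n| ^+ 3 in Num.max (- q) (Num.min (err n) q).
have q0 n : 0 <= Q * `|eta n| ^+ 3 by rewrite mulr_ge0// exprn_ge0.
have mR n : 0 < (m n)%:R :> R by rewrite ltr0n.
exists (fun n => (m n)%:R^-1 * (err n - clip n)), (fun n => (m n)%:R^-1 * clip n); split.
- move=> n; rewrite varE; congr (_%:E).
  have -> : kernel_V K / (12 * (m n)%:R * n%:R ^+ 2 * h n (m n)) *
      (jump G x / f x ^+ 2) = (m n)%:R^-1 * V n.
    by rewrite /V -/(b n) !invfM; ring.
  by rewrite /err -/(b n); ring.
- apply/eqoP => e e0; near=> n.
  have n0 : (0 < n)%N by near: n; exact: nbhs_infty_gt.
  have eta0 : 0 < eta n by rewrite invr_gt0 mulr_gt0 ?ltr0n ?b_gt0.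
  have He : `|err n| <= Q * eta n ^+ 3 + e * b n by near: n; exact: HQ.
  have [_ Hc] := clip_bounds (err n) (q0 n).
  have eb0 : 0 <= e * b n by rewrite mulr_ge0 ?(ltW e0) ?(ltW (b_gt0 _ n0)).
  have := Hc _ eb0; rewrite (gtr0_norm eta0) => /(_ He) H.
  have bm : 0 <= b n / (m n)%:R by rewrite divr_ge0// ltW// b_gt0.
  rewrite -/(b n) normrM (ger0_norm bm) gtr0_norm ?invr_gt0//.
  rewrite mulrA mulrC ler_wpM2r ?invr_ge0//.
  by rewrite /clip (gtr0_norm eta0).
- apply/eqO_exP; exists (Q + 1); first by rewrite ltr_wpDl.
  near=> n.
  have n0 : (0 < n)%N by near: n; exact: nbhs_infty_gt.
  have eta0 : 0 < eta n by rewrite invr_gt0 mulr_gt0 ?ltr0n ?b_gt0.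
  have [Hc _] := clip_bounds (err n) (q0 n).
  have A0 : 0 <= ((m n)%:R * n%:R ^+ 2)^-1 :> R by rewrite invr_ge0 mulr_ge0// exprn_ge0.
  have E : ((m n)%:R * n%:R ^+ 3 * b n ^+ 3)^-1 = (m n)%:R^-1 * eta n ^+ 3.
    by rewrite /eta exprVn -[RHS]invfM; congr (_^-1); ring.
  have B0 : 0 <= (m n)%:R^-1 * eta n ^+ 3 by rewrite mulr_ge0 ?invr_ge0// exprn_ge0// ltW.
  rewrite -/(b n) E normrM (ger0_norm (addr_ge0 A0 B0)) gtr0_norm ?invr_gt0//.
  rewrite (@le_trans _ _ ((m n)%:R^-1 * (Q * `|eta n| ^+ 3)))//.
    by rewrite ler_wpM2l// invr_ge0.
  rewrite (gtr0_norm eta0) mulrCA ler_pM//; first by rewrite lerDl.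
  by rewrite lerDr.
Unshelve. all: by end_near. Qed.
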